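(* Let $R=k[x_1,\dots,x_n]$ be positively graded by $\deg(x_i)=a_i\in A$, let $I\subset R$ be a homogeneous ideal and let $\Omega\subset S_A$ be a truncating subset. Let $G$ be a (finite) universal Gröbner basis for $I$ consisting of homogeneous elements, put $S=\{\deg(g)\mid g\in G\}$, and let $$\operatorname{State}_\Omega(I)=\operatorname{State}_{\Omega\cap S}(I)=\sum_{a\in\Omega\cap S}\operatorname{State}_a(I).$$ Then the normal fan of $\operatorname{State}_\Omega(I)$ is the truncated Gröbner fan $\mathcal{F}_\Omega(I)$. Consequently $\mathcal{F}_\Omega(I)$ is the normal fan of a Minkowski summand of the state polytope $\operatorname{State}_S(I)=\sum_{a\in S}\operatorname{State}_a(I)$ of $I$, and $\mathcal{F}_\Omega(I)$ is a coarsening of the usual Gröbner fan of $I$.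
   Context: $k$ is a field, $R=k[x_1,\dots,x_n]$, and $a_1,\dots,a_n$ are elements of an abelian group $(A,+)$. $\mathbb{N}$ contains $0$. Put $S_A=\mathbb{N}a_1+\cdots+\mathbb{N}a_n\subset A$ and $\deg(x^v)=v_1a_1+\cdots+v_na_n$ for $v\in\mathbb{N}^n$. For $s\in A$ let $R_s$ be the $k$-span of the monomials of degree $s$; this gives an $A$-grading of $R$. $R$ is positively graded if $R_0=k$ (equivalently $\dim_k R_s<\infty$ for all $s\in S_A$). For an ideal $J$, $J_s=J\cap R_s$, and $J$ is homogeneous if $J=\bigoplus_s J_s$. A subset $\Omega\subset S_A$ is truncating if for all $s,t\in S_A$, $s+t\in\Omega$ implies $s,t\in\Omega$. For a homogeneous ideal $J$ put $J_\Omega=\bigoplus_{s\in\Omega}J_s$. A total multiplicative ordering $\prec$ is a total order on the monomials of $R$ with $x^u\prec x^v\Rightarrow x^{u+w}\prec x^{v+w}$; the monomial $1$ is not required to be minimal. $\operatorname{in}_\prec(f)$ is the $\prec$-maximal term of $f\ne0$ and $\operatorname{in}_\prec(I)$ is the ideal generated by the $\operatorname{in}_\prec(f)$, $f\in I\setminus\{0\}$. For $\omega\in\mathbb{R}^n$, $\operatorname{in}_\omega(f)$ is the sum of the terms $c_vx^v$ of $f$ with $\omega\cdot v$ maximal and $\operatorname{in}_\omega(I)$ is the ideal generated by the $\operatorname{in}_\omega(f)$, $f\in I\setminus\{0\}$. A universal Gröbner basis of $I$ is a finite subset of $I$ which is a Gröbner basis of $I$ over every total multiplicative ordering $\prec$,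 i.e. its initial terms generate $\operatorname{in}_\prec(I)$. For $a\in A$ put $\Sigma\operatorname{in}_\prec(I)_a=\sum_{x^v\in\operatorname{in}_\prec(I)_a}v\in\mathbb{N}^n$ (sum over the finitely many monomials in $\operatorname{in}_\prec(I)_a$), and $$\operatorname{State}_a(I)=\operatorname{conv}\{\Sigma\operatorname{in}_\prec(I)_a\mid\prec\text{ a total multiplicative ordering}\}\subset\mathbb{R}^n.$$ Sums of polytopes are Minkowski sums, the empty sum being $\{0\}$. The truncated Gröbner fan is $\mathcal{F}_\Omega(I)=\{\overline{C_\Omega[\omega]}\mid\omega\in\mathbb{R}^n\}$, where $C_\Omega[\omega]=\{v\in\mathbb{R}^n\mid\operatorname{in}_v(I)_\Omega=\operatorname{in}_\omega(I)_\Omega\}$. The usual Gröbner fan is the case $\Omega=S_A$, i.e. it consists of the closures of the sets $\{v\in\mathbb{R}^n\mid\operatorname{in}_v(I)=\operatorname{in}_\omega(I)\}$. For a polytope $P$, $\operatorname{face}_\omega(P)=\{p\in P\mid \omega\cdot p\ge\omega\cdot q\ \forall q\in P\}$, and the normal fan of $P$ is the outer one: its cones are the closures of the sets $\{v\in\mathbb{R}^n\mid\operatorname{face}_v(P)=\operatorname{face}_\omega(P)\}$. A fan is a coarsening of another if every cone of the latter is contained in a cone of the former. *)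

(* Defs.v *)
From HB Require Import structures.
From mathcomp Require Import all_boot all_order all_algebra.
From mathcomp Require mpoly.
(* The notations of mpoly clash with those of MathComp-Analysis. *)
Import -(notations) mpoly.
From mathcomp Require Import all_classical all_reals topology normedtype convex.

Set Implicit Arguments.
Unset Strict Implicit.
Unset Printing Implicit Defensive.

Import Order.TTheory GRing.Theory Num.Theory.
Import numFieldNormedType.Exports.

Local Open Scope classical_set_scope.
Local Open Scope ring_scope.

(* A monomial x^m of k[x_1, ..., x_n] is given by its exponent vector
   m : multinom n, and it is the polynomial mpolyX k m. *)

Definition mdegA (n : nat) (A : zmodType) (a : 'I_n -> A) (m : multinom n) : A :=
  \sum_(i < n) a i *+ m i.

(* S_A = N a_1 + ... + N a_n *)
Definition deg_monoid (n : nat) (A : zmodType) (a : 'I_n -> A) : set A :=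
  range (mdegA a).

(* R_s *)
Definition graded_piece (k : fieldType) (n : nat) (A : zmodType)
    (a : 'I_n -> A) (s : A) : set (mpoly n k) :=
  [set f | forall m, m \in msupp f -> mdegA a m = s].

Definition positively_graded (k : fieldType) (n : nat) (A : zmodType)
    (a : 'I_n -> A) : Prop :=
  graded_piece a 0 = range (@mpolyC n k).

(* The unit ideal is allowed. *)
Definition is_ideal (k : fieldType) (n : nat) (J : set (mpoly n k)) : Prop :=
  [/\ J 0,
      forall f g, J f -> J g -> J (f + g)
    & forall h f, J f -> J (h * f)].

Definition ideal_gen (k : fieldType) (n : nat) (B : set (mpoly n k)) :
    set (mpoly n k) :=
  smallest (@is_ideal k n) B.

(* J_Om, the sum of the J_s = J \cap R_s over s in Om; the sum is direct because
   the R_s are independent. *)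
Definition truncation (k : fieldType) (n : nat) (A : zmodType) (a : 'I_n -> A)
    (Om : set A) (J : set (mpoly n k)) : set (mpoly n k) :=
  [set f | exists (r : seq A) (g : A -> mpoly n k),
    [/\ uniq r,
        forall s, s \in r -> Om s /\ (J `&` graded_piece a s) (g s)
      & f = \sum_(s <- r) g s]].

Definition homogeneous_ideal (k : fieldType) (n : nat) (A : zmodType)
    (a : 'I_n -> A) (J : set (mpoly n k)) : Prop :=
  is_ideal J /\ J = truncation a setT J.

Definition truncating (n : nat) (A : zmodType) (a : 'I_n -> A) (Om : set A) :
    Prop :=
  Om `<=` deg_monoid a /\
  forall s t, deg_monoid a s -> deg_monoid a t -> Om (s + t) -> Om s /\ Om t.

(* The zero polynomial, being homogeneous of every degree, contributes no
   degree. *)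
Definition degrees (k : fieldType) (n : nat) (A : zmodType) (a : 'I_n -> A)
    (G : set (mpoly n k)) : set A :=
  [set s | exists2 g, (G `\ 0) g & graded_piece a s g].

(* lt is the strict order; 1 need not be its least monomial. *)
Definition mult_order (n : nat) (lt : rel (multinom n)) : Prop :=
  [/\ irreflexive lt,
      transitive lt,
      forall u v, u != v -> lt u v || lt v u
    & forall u v w, lt u v -> lt (mnm_add u w) (mnm_add v w)].

(* For f != 0 and a total order lt, exactly one term passes the filter. *)
Definition in_ord (k : fieldType) (n : nat) (lt : rel (multinom n))
    (f : mpoly n k) : mpoly n k :=
  \sum_(m <- msupp f | all (fun u => (u == m) || lt u m) (msupp f))
     mcoeff m f *: mpolyX k m.

Definition in_ord_ideal (k : fieldType) (n : nat) (lt : rel (multinom n))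
    (I : set (mpoly n k)) : set (mpoly n k) :=
  ideal_gen (in_ord lt @` (I `\ 0)).

Definition universal_grobner_basis (k : fieldType) (n : nat)
    (I G : set (mpoly n k)) : Prop :=
  [/\ finite_set G,
      G `<=` I
    & forall lt, mult_order lt ->
        ideal_gen (in_ord lt @` (G `\ 0)) = in_ord_ideal lt I].

Definition dotv (R : realType) (n : nat) (u v : 'rV[R]_n) : R :=
  \sum_(i < n) u 0 i * v 0 i.

Definition expvec (R : realType) (n : nat) (m : multinom n) : 'rV[R]_n :=
  \row_(i < n) (m i)%:R.

Definition in_wt (R : realType) (k : fieldType) (n : nat) (w : 'rV[R]_n)
    (f : mpoly n k) : mpoly n k :=
  \sum_(m <- msupp f |
          all (fun u => dotv w (expvec R u) <= dotv w (expvec R m)) (msupp f))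
     mcoeff m f *: mpolyX k m.

Definition in_wt_ideal (R : realType) (k : fieldType) (n : nat) (w : 'rV[R]_n)
    (I : set (mpoly n k)) : set (mpoly n k) :=
  ideal_gen (in_wt w @` (I `\ 0)).

Definition conv_hull (R : realType) (n : nat) (V : set 'rV[R]_n) :
    set 'rV[R]_n :=
  smallest (@convex_set R 'rV[R]_n) V.

Definition polytope (R : realType) (n : nat) (P : set 'rV[R]_n) : Prop :=
  exists2 V : set 'rV[R]_n, finite_set V & P = conv_hull V.

Definition minkowski_sum (R : realType) (n : nat) (P Q : set 'rV[R]_n) :
    set 'rV[R]_n :=
  [set p + q | p in P & q in Q].

Lemma minkowski_sumA (R : realType) (n : nat) :
  associative (@minkowski_sum R n).
Proof.
move=> P Q S; apply/seteqP; split=> x /=.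
- move=> [p Pp [_ [q Qq [s Ss <-]] <-]]; exists (p + q); first by exists p => //; exists q.
  by exists s => //; rewrite addrA.
- move=> [_ [p Pp [q Qq <-]] [s Ss <-]]; exists p => //; exists (q + s).
    by exists q => //; exists s.
  by rewrite addrA.
Qed.

Lemma minkowski_sumC (R : realType) (n : nat) :
  commutative (@minkowski_sum R n).
Proof.
move=> P Q; apply/seteqP; split=> x [p Pp [q Qq <-]];
by exists q => //; exists p => //; rewrite addrC.
Qed.

Lemma minkowski_sum0 (R : realType) (n : nat) :
  left_id [set 0] (@minkowski_sum R n).
Proof.
move=> P; apply/seteqP; split=> x /=.
- by move=> [_ -> [q Qq <-]]; rewrite add0r.
- by move=> Px; exists 0 => //; exists x => //; rewrite add0r.
Qed.

HB.instance Definition _ (R : realType) (n : nat) :=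
  Monoid.isComLaw.Build (set 'rV[R]_n) [set 0] (@minkowski_sum R n)
    (@minkowski_sumA R n) (@minkowski_sumC R n) (@minkowski_sum0 R n).

Definition minkowski_summand (R : realType) (n : nat) (P Q : set 'rV[R]_n) :
    Prop :=
  polytope P /\ exists2 P', polytope P' & Q = minkowski_sum P P'.

Definition face (R : realType) (n : nat) (w : 'rV[R]_n) (P : set 'rV[R]_n) :
    set 'rV[R]_n :=
  [set p | P p /\ forall q, P q -> dotv w q <= dotv w p].

(* The outer normal fan, as the set of its cones. *)
Definition normal_fan (R : realType) (n : nat) (P : set 'rV[R]_n) :
    set (set 'rV[R]_n) :=
  range (fun w : 'rV[R]_n =>
    closure [set v : 'rV[R]_n | face v P = face w P]).

Definition coarsening (R : realType) (n : nat) (F F' : set (set 'rV[R]_n)) :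
    Prop :=
  forall C', F' C' -> exists2 C, F C & C' `<=` C.

(* The index set is finite when the grading is positive (a finitely supported
   big operator over an infinite support would be 0). *)
Definition initial_sum (R : realType) (k : fieldType) (n : nat) (A : zmodType)
    (a : 'I_n -> A) (I : set (mpoly n k)) (s : A) (lt : rel (multinom n)) :
    'rV[R]_n :=
  \sum_(m \in [set m : multinom n |
                (in_ord_ideal lt I `&` graded_piece a s) (mpolyX k m)])
     expvec R m.
Arguments initial_sum R {k n A} a I s lt.

Definition state (R : realType) (k : fieldType) (n : nat) (A : zmodType)
    (a : 'I_n -> A) (I : set (mpoly n k)) (s : A) : set 'rV[R]_n :=
  conv_hull (initial_sum R a I s @` (@mult_order n)).
Arguments state R {k n A} a I s.

(* The Minkowski sum of the State_s(I) over a finite set T of degrees. *)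
Definition state_sum (R : realType) (k : fieldType) (n : nat) (A : zmodType)
    (a : 'I_n -> A) (I : set (mpoly n k)) (T : set A) : set 'rV[R]_n :=
  \big[@minkowski_sum R n/[set 0]]_(s \in T) state R a I s.
Arguments state_sum R {k n A} a I T.

Definition truncated_grobner_fan (R : realType) (k : fieldType) (n : nat)
    (A : zmodType) (a : 'I_n -> A) (I : set (mpoly n k)) (Om : set A) :
    set (set 'rV[R]_n) :=
  range (fun w : 'rV[R]_n =>
    closure [set v : 'rV[R]_n |
      truncation a Om (in_wt_ideal v I) = truncation a Om (in_wt_ideal w I)]).
Arguments truncated_grobner_fan R {k n A} a I Om.

Definition grobner_fan (R : realType) (k : fieldType) (n : nat)
    (I : set (mpoly n k)) : set (set 'rV[R]_n) :=
  range (fun w : 'rV[R]_n =>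
    closure [set v : 'rV[R]_n | in_wt_ideal v I = in_wt_ideal w I]).
Arguments grobner_fan R {k n} I.

(* Main.v *)
Require Import Defs.
From HB Require Import structures.
From mathcomp Require Import all_boot all_order all_algebra.
From mathcomp Require mpoly.
Import -(notations) mpoly.
From mathcomp Require Import all_classical all_reals topology normedtype convex.
From mathcomp Require Import perm interval_inference.

Set Implicit Arguments.
Unset Strict Implicit.
Unset Printing Implicit Defensive.

Import Order.TTheory GRing.Theory Num.Theory.
Import numFieldNormedType.Exports.

Local Open Scope classical_set_scope.
Local Open Scope ring_scope.

(** Everything is reduced to one degree [s] at a time. There [L], the piece of
[I] of degree [s], is a space of polynomials supported on the finitely many
monomials of degree [s] (finitely many by [dickson], since a positive grading
makes them an antichain), and the piece of degree [s] of an initial ideal of [I]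
is the space spanned by the initial forms of [L] ([init_ideal_piece]).

The sets of monomials on which the elements of [L] are determined by
arbitrarily prescribed coefficients are the bases of a matroid, and each
monomial order yields one of them: the monomials of the initial ideal. For a
weight [w], expanding the determinant that compares two bases shows that a basis
has maximal total weight exactly when it is still a basis for the space of
[w]-initial forms of [L] ([weight_le_adapted], [weight_eq_adapted]). Hence that
space determines which vertices of the state polytope of degree [s] maximize
[w]. Conversely, suppose that [v] and [w] are maximized by the same vertices.
The order that compares by [v], then by [-w], gives a reduced basis of [L] that
is at once a [v]- and a [w]-initial basis, and in which the terms tied for [v] with
the initial monomial are tied with it for [w]; exchanging the roles of [v] and [w] shows that the two spaces of
initial forms are equal. This is [init_space_eqP], and through it
[state_face_eqP]: the states of degree [s] have equal faces for [v] and [w] if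
and only if the initial ideals agree in degree [s].

A face of a Minkowski sum determines the faces of its summands
([face_sum_eqP]), so the normal fan of the sum over the degrees of [G] in [Om]
records the agreement of initial ideals in those degrees. Agreement then
propagates to every degree in [Om] ([init_piece_extend]): an initial monomial of
degree in [Om] is a multiple of the initial monomial of some [g] in [G], whose
degree lies in [Om] because [Om] is truncating, so the common part of the two
initial ideals already has all the initial monomials, and nothing smaller than
the whole has. Splitting the sum over all degrees of [G] along [Om] exhibits the
summand, and the coarsening holds because an initial ideal determines its
truncation. *)

(** * Spaces of polynomials and their bases of monomials *)

Section Subspaces.
Variables (k : fieldType) (n : nat).
Implicit Types (f g h : mpoly n k) (L : set (mpoly n k)) (m u : multinom n).

Definition sub_poly (p : pred (multinom n)) f : mpoly n k :=
  \sum_(m <- msupp f | p m) mcoeff m f *: mpolyX k m.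

Lemma mcoeff_sub_poly p f m :
  mcoeff m (sub_poly p f) = if p m then mcoeff m f else 0.
Proof.
rewrite raddf_sum /= (eq_bigr (fun u => mcoeff u f * (u == m)%:R)); last first.
  by move=> u _; rewrite mcoeffZ mcoeffX.
rewrite big_mkcond /=; have [mf|mf] := boolP (m \in msupp f); last first.
  rewrite (memN_msupp_eq0 mf) if_same big_seq big1// => u uf.
  have [um|um] := eqVneq u m; first by rewrite -um uf in mf.
  by rewrite mulr0 if_same.
rewrite (bigD1_seq m) ?msupp_uniq//= eqxx mulr1 big1 ?addr0// => u um.
by rewrite (negPf um) mulr0 if_same.
Qed.

Lemma sub_poly0 p : sub_poly p 0 = 0.
Proof. by apply/mpolyP => m; rewrite mcoeff_sub_poly mcoeff0 if_same. Qed.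

Lemma sub_poly_linear p c f g :
  sub_poly p (c *: f + g) = c *: sub_poly p f + sub_poly p g.
Proof.
apply/mpolyP => m; rewrite !(mcoeffD, mcoeffZ, mcoeff_sub_poly).
by case: ifP => _; rewrite ?mulr0 ?addr0.
Qed.

Lemma sub_poly_all (p : pred (multinom n)) f :
  (forall m, m \in msupp f -> p m) -> sub_poly p f = f.
Proof.
move=> pf; apply/mpolyP => m; rewrite mcoeff_sub_poly.
by case: ifP => // /negbT pm; apply/esym/memN_msupp_eq0; apply: contra pm => /pf.
Qed.

Lemma sub_poly_none (p : pred (multinom n)) f :
  (forall m, m \in msupp f -> ~~ p m) -> sub_poly p f = 0.
Proof.
move=> pf; apply/mpolyP => m; rewrite mcoeff_sub_poly mcoeff0.
by case: ifP => // pm; apply/memN_msupp_eq0/negP => /pf; rewrite pm.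
Qed.

Definition lin_closed L : Prop :=
  L 0 /\ forall c f g, L f -> L g -> L (c *: f + g).

Lemma lin_closedZ L c f : lin_closed L -> L f -> L (c *: f).
Proof. by move=> [L0 LD] Lf; rewrite -[_ *: _]addr0; exact: LD. Qed.

Lemma lin_closedD L f g : lin_closed L -> L f -> L g -> L (f + g).
Proof. by move=> [L0 LD] Lf Lg; rewrite -[f]scale1r; exact: LD. Qed.

Lemma lin_closedB L f g : lin_closed L -> L f -> L g -> L (f - g).
Proof.
by move=> sL Lf Lg; rewrite -scaleN1r; apply: lin_closedD => //; exact: lin_closedZ.
Qed.

Lemma lin_closed_sum L (T : eqType) (s : seq T) (F : T -> mpoly n k) :
  lin_closed L -> (forall i, i \in s -> L (F i)) -> L (\sum_(i <- s) F i).
Proof.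
move=> sL LF; rewrite big_seq.
by apply: big_ind => //; [case: sL | move=> f g; exact: lin_closedD].
Qed.

Definition linspan (V : set (mpoly n k)) : set (mpoly n k) := smallest lin_closed V.

Lemma lin_closed_linspan V : lin_closed (linspan V).
Proof.
split; first by move=> L [[L0 _] _].
by move=> c f g sf sg L VL; case: (VL) => [[_ LD] _]; apply: LD; [exact: sf|exact: sg].
Qed.

Lemma sub_linspan V : V `<=` linspan V.
Proof. exact: sub_gen_smallest. Qed.

Lemma linspan_sub V L : lin_closed L -> V `<=` L -> linspan V `<=` L.
Proof. exact: smallest_sub. Qed.

(** The monomials [B] form a coordinate system on [L], with dual vectors [F];
such [B] are the bases of the matroid that [L] defines on the monomials. *)
Definition dual_family L (B : seq (multinom n)) (F : multinom n -> mpoly n k) :=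
  [/\ uniq B,
      forall m, m \in B -> L (F m),
      forall m u, m \in B -> u \in B -> mcoeff u (F m) = (m == u)%:R
    & forall f, L f -> f = \sum_(m <- B) mcoeff m f *: F m].

Lemma mcoeff_dual_family L B F f u : dual_family L B F -> L f ->
  mcoeff u f = \sum_(m <- B) mcoeff m f * mcoeff u (F m).
Proof.
move=> [_ _ _ e] Lf; rewrite {1}(e f Lf) raddf_sum.
by apply: eq_bigr => m _; rewrite /= mcoeffZ.
Qed.

(** The dimensions are parameters, meant to be the sizes of [B] and [B'], so that
the matrix between two bases of equal size is square and has a determinant. *)
Definition transition d d' (B B' : seq (multinom n))
    (F : multinom n -> mpoly n k) : 'M[k]_(d, d') :=
  \matrix_(i, j) mcoeff (nth (@mnm0 n) B' j) (F (nth (@mnm0 n) B i)).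

Lemma transitionK L B B' F F' d d' : size B = d -> size B' = d' ->
  dual_family L B F -> dual_family L B' F' ->
  transition d d' B B' F *m transition d' d B' B F' = 1%:M.
Proof.
move=> <- <- bB bB'; apply/matrixP => i j; rewrite !mxE.
have [uB LB dB _] := bB.
have iB (l : 'I_(size B)) : nth (@mnm0 n) B l \in B by rewrite mem_nth.
rewrite -[i == j](nth_uniq (@mnm0 n) (ltn_ord i) (ltn_ord j) uB).
rewrite -(dB _ _ (iB i) (iB j)) (mcoeff_dual_family _ bB' (LB _ (iB i))).
by rewrite (big_nth (@mnm0 n)) big_mkord; apply: eq_bigr => l _; rewrite !mxE.
Qed.

Lemma dual_family_size L B B' F F' :
  dual_family L B F -> dual_family L B' F' -> size B = size B'.
Proof.
move=> bB bB'; apply/eqP; rewrite eqn_leq.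
by rewrite (mulmx1_min (transitionK erefl erefl bB bB'))
           (mulmx1_min (transitionK erefl erefl bB' bB)).
Qed.

End Subspaces.

(** * Initial forms for a total preorder *)

Section InitialForms.
Variables (k : fieldType) (n : nat).
Implicit Types (f g h : mpoly n k) (L : set (mpoly n k)) (m u : multinom n).
Implicit Types (r : rel (multinom n)).

(** Monomial orders and weights are treated together: [in_ord] and [in_wt] are
both convertible to [init_form], for the preorders [order_le] and [weight_le]
below. *)
Definition init_form r f : mpoly n k := sub_poly (fun m => all (r^~ m) (msupp f)) f.

Definition init_space r L : set (mpoly n k) := linspan (init_form r @` L).

Definition leading r f m := m \in msupp f /\ forall u, u \in msupp f -> r u m.

Definition total_preorder r := total r /\ transitive r.

Lemma init_form0 r : init_form r 0 = 0.
Proof. by apply/mpolyP => m; rewrite mcoeff_sub_poly mcoeff0 if_same. Qed.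

Lemma total_preorder_refl r m : total_preorder r -> r m m.
Proof. by move=> [tr _]; move: (tr m m); rewrite orbb. Qed.

Lemma leading_exists r f : total_preorder r -> f != 0 -> exists m, leading r f m.
Proof.
move=> pr; rewrite -msupp_eq0 /leading; case: (msupp f) => // m0 s _.
elim: s m0 => [|m1 s ih] m0.
  exists m0; split; first exact: mem_head.
  by move=> u; rewrite inE => /eqP ->; exact: total_preorder_refl.
have [m [ms rm]] := ih m1; have [tr trr] := pr.
have [rm0|rm0] := orP (tr m0 m).
  exists m; split; first by rewrite inE ms orbT.
  by move=> u; rewrite inE => /predU1P[->|/rm].
exists m0; split; first exact: mem_head.
move=> u; rewrite inE => /predU1P[->|/rm um]; first exact: total_preorder_refl.
exact: trr um rm0.
Qed.

Lemma mcoeff_init_form r f m u : total_preorder r -> leading r f m ->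
  mcoeff u (init_form r f) = if r m u then mcoeff u f else 0.
Proof.
move=> [_ tr] [mf lm]; rewrite mcoeff_sub_poly; congr (if _ then _ else _).
apply/allP/idP => [/(_ m mf)//|mu v /lm vm]; exact: tr vm mu.
Qed.

Lemma init_form_eq0 r f : total_preorder r -> init_form r f = 0 -> f = 0.
Proof.
move=> pr i0; apply/eqP/negPn/negP => /(leading_exists pr)[m lm].
have := mcoeff_init_form m pr lm; rewrite i0 mcoeff0 total_preorder_refl// => /esym/eqP.
by rewrite mcoeff_eq0 lm.1.
Qed.

(** For the preorder of a monomial order, a dual family with this property is a
reduced Groebner basis of [L]. *)
Definition adapted r (B : seq (multinom n)) (F : multinom n -> mpoly n k) :=
  forall m u, m \in B -> u \in msupp (F m) -> r u m.

Lemma adapted_leading L r B F m :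
  dual_family L B F -> adapted r B F -> m \in B -> leading r (F m) m.
Proof.
move=> [_ _ dB _] aB mB; split; last by move=> u; exact: aB.
by rewrite mcoeff_msupp dB// eqxx oner_neq0.
Qed.

(** No cancellation occurs among leading terms: the coefficients of [f] on [B]
are its coordinates, and adaptedness puts the leading terms of [f] exactly in the
[F m] whose [m] is itself leading in [f]. *)
Lemma dual_family_init_form L r B F : total_preorder r ->
  dual_family L B F -> adapted r B F ->
  dual_family (init_space r L) B (init_form r \o F).
Proof.
move=> pr bB aB; have [uB LB dB eB] := bB.
have iF m u : m \in B ->
    mcoeff u (init_form r (F m)) = if r m u then mcoeff u (F m) else 0.
  by move=> mB; apply: mcoeff_init_form => //; exact: adapted_leading bB aB mB.
split=> //.
- by move=> m mB; apply: sub_linspan; exists (F m) => //; exact: LB.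
- move=> m u mB uB' /=; rewrite iF// dB//; case: eqP => [->|_]; last by rewrite if_same.
  by rewrite total_preorder_refl.
apply: linspan_sub.
  split.
    by rewrite big1// => m _; rewrite mcoeff0 scale0r.
  move=> c f g ef eg; rewrite {1}ef {1}eg scaler_sumr -big_split/=.
  by apply: eq_bigr => m _; rewrite mcoeffD mcoeffZ scalerDl scalerA.
move=> _ [f Lf <-].
have [->|f0] := eqVneq f 0.
  by rewrite init_form0 big1// => m _; rewrite mcoeff0 scale0r.
have [m0 lm0] := leading_exists pr f0; have [m0f m0l] := lm0; have [_ tr] := pr.
apply/mpolyP => u; rewrite (mcoeff_init_form _ pr lm0) raddf_sum/=.
transitivity (\sum_(m <- B)
    if r m0 u then mcoeff m f * mcoeff u (F m) else 0).
  by case: ifP => _; [exact: mcoeff_dual_family bB Lf | rewrite big1].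
rewrite big_seq [RHS]big_seq; apply: eq_bigr => m mB.
rewrite mcoeffZ iF// (mcoeff_init_form _ pr lm0).
have [->|] := eqVneq (mcoeff m f) 0; first by rewrite !(mul0r, if_same).
rewrite -mcoeff_msupp => /m0l rm.
have [->|] := eqVneq (mcoeff u (F m)) 0; first by rewrite !(mulr0, if_same).
rewrite -mcoeff_msupp => /(aB _ _ mB) ru.
case: ifP => [m0u|m0u].
  by rewrite (tr _ _ _ m0u ru) (tr _ _ _ rm m0u).
case: ifP => [m0m|_]; last by rewrite mul0r.
by case: ifP => [mu|_]; [rewrite (tr _ _ _ m0m mu) in m0u | rewrite mulr0].
Qed.

End InitialForms.

(** * Bases of maximal weight *)

(** Otherwise every term of the Leibniz formula vanishes. *)
Lemma det_neq0_transversal (F : fieldType) d (M : 'M[F]_d) :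
  \det M != 0 -> exists s : 'S_d, forall i, M i (s i) != 0.
Proof.
move=> dM; apply/not_existsP => noS; case/eqP: dM.
rewrite /determinant big1// => s _.
have /existsNP[i /negP/negPn/eqP Mi0] := noS s.
by rewrite (bigD1 i)//= Mi0 mul0r mulr0.
Qed.

Section Weights.
Variables (R : realDomainType) (k : fieldType) (n : nat).
Variable w : multinom n -> R.
Implicit Types (f g h : mpoly n k) (L : set (mpoly n k)) (m u : multinom n).

Definition weight_le : rel (multinom n) := fun u m => w u <= w m.

Lemma weight_le_preorder : total_preorder weight_le.
Proof.
split=> [u m|u m v]; rewrite /weight_le; first exact: le_total.
exact: le_trans.
Qed.

Definition weight (B : seq (multinom n)) : R := \sum_(m <- B) w m.

Lemma weight_nth d B : size B = d ->
  weight B = \sum_(i < d) w (nth (@mnm0 n) B i).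
Proof. by move=> <-; rewrite /weight (big_nth (@mnm0 n)) big_mkord. Qed.

Lemma weight_perm d B (s : 'S_d) : size B = d ->
  weight B = \sum_(i < d) w (nth (@mnm0 n) B (s i)).
Proof. by move=> sB; rewrite (weight_nth sB) (reindex_inj (@perm_inj _ s)). Qed.

Section TwoBases.
Variables (L : set (mpoly n k)) (B B' : seq (multinom n)).
Variables (F F' : multinom n -> mpoly n k).
Hypotheses (bB : dual_family L B F) (aB : adapted weight_le B F).
Hypothesis bB' : dual_family L B' F'.

Let d := size B.
Let sB' : size B' = d := esym (dual_family_size bB bB').
Let M := transition d d B B' F.
Let M0 := transition d d B B' (init_form weight_le \o F).
Let b (i : 'I_d) := nth (@mnm0 n) B i.
Let b' (i : 'I_d) := nth (@mnm0 n) B' i.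

Let b_in i : b i \in B. Proof. by rewrite mem_nth. Qed.
Let b'_in i : b' i \in B'. Proof. by rewrite mem_nth// sB'. Qed.

Let detM : \det M != 0.
Proof.
have := congr1 determinant (transitionK erefl sB' bB bB').
rewrite det_mulmx det1 => dMM; apply: contra_eq_neq dMM => ->.
by rewrite mul0r eq_sym oner_neq0.
Qed.

Let ME i j : M i j != 0 -> w (b' j) <= w (b i).
Proof. by rewrite mxE -mcoeff_msupp => /(aB (b_in i)). Qed.

Let M0E i j : M0 i j = if w (b i) <= w (b' j) then M i j else 0.
Proof.
rewrite !mxE /=; apply: mcoeff_init_form; first exact: weight_le_preorder.
exact: adapted_leading bB aB (b_in i).
Qed.

(** A nonzero term of the determinant of [M] is a bijection from [B] to [B'] that
moves each [m] to a monomial of [F m], which is not heavier than [m]. *)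
Lemma weight_le_adapted : weight B' <= weight B.
Proof.
have [s Ms] := det_neq0_transversal detM.
by rewrite (weight_perm s sB') (weight_nth erefl); apply: ler_sum => i _; apply: ME.
Qed.

(* Weight-preserving bijections contribute the same term to both determinants;
   all others contribute zero to [\det M0], and also to [\det M] when the total
   weights agree, by [ME]. *)
Let detM0 : weight B' = weight B <-> \det M0 != 0.
Proof.
split=> [wE|/det_neq0_transversal[s M0s]]; last first.
  rewrite (weight_perm s sB') (weight_nth erefl); apply: eq_bigr => i _.
  have := M0s i; rewrite M0E; case: ifP => [le1 /ME le2|_]; last by rewrite eqxx.
  by apply/eqP; rewrite eq_le le1 le2.
suff -> : \det M0 = \det M by [].
apply: eq_bigr => s _; congr (_ * _).
have [Ms|] := boolP [forall i, M i (s i) != 0]; last first.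
  rewrite negb_forall => /existsP[i /negPn/eqP Mi].
  by rewrite (bigD1 i)//= [RHS](bigD1 i)//= M0E Mi if_same !mul0r.
apply: eq_bigr => i _; rewrite M0E ifT//.
have ge0 j : true -> 0 <= w (b j) - w (b' (s j)).
  by move=> _; rewrite subr_ge0 ME//; exact: (forallP Ms).
have : \sum_j (w (b j) - w (b' (s j))) = 0.
  by rewrite sumrB -(weight_nth erefl) -(weight_perm s sB') wE subrr.
by move=> /(psumr_eq0P ge0)/(_ i erefl)/subr0_eq ->.
Qed.

(** The right-hand side says that [B'] is a basis also for the space of initial
forms. It depends on [w] only through that space, so equal spaces of initial forms
have the same bases of maximal weight. *)
Lemma weight_eq_adapted : weight B' = weight B <->
  forall h, init_space weight_le L h ->
    (forall m, m \in B' -> mcoeff m h = 0) -> h = 0.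
Proof.
have bI := dual_family_init_form weight_le_preorder bB aB.
have [uB LB dB eB] := bI.
rewrite detM0; split=> [dM h Lh h0|H].
  have := eB h Lh; set v : 'rV[k]_d := \row_i mcoeff (b i) h.
  have v0 : v = 0.
    apply/eqP; apply: contraNT dM => v0; apply/det0P; exists v => //.
    apply/rowP => j; rewrite !mxE -[RHS](h0 _ (b'_in j)) (mcoeff_dual_family _ bI Lh).
    rewrite (big_nth (@mnm0 n)) big_mkord; apply: eq_bigr => i _.
    by rewrite !mxE.
  rewrite (big_nth (@mnm0 n)) big_mkord big1// => i _.
  by have /rowP/(_ i) := v0; rewrite !mxE => ->; rewrite scale0r.
apply/det0P => -[v /rV0Pn[i vi] vM].
pose h := \sum_(j < d) v 0 j *: init_form weight_le (F (b j)).
have hE m : mcoeff m h = \sum_(j < d) v 0 j * mcoeff m (init_form weight_le (F (b j))).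
  by rewrite raddf_sum; apply: eq_bigr => j _; exact: mcoeffZ.
case/eqP: vi; rewrite -[RHS](mcoeff0 k (b i)) -(H h).
- rewrite hE (bigD1 i)//= dB// eqxx mulr1 big1 ?addr0// => j ji.
  by rewrite dB// nth_uniq// val_eqE (negPf ji) mulr0.
- apply: (@lin_closed_sum _ _ (init_space weight_le L)).
    exact: lin_closed_linspan.
  by move=> j _; apply: (lin_closedZ _ (@lin_closed_linspan _ _ _)); exact: LB (b_in j).
move=> m /(nthP (@mnm0 n))[j]; rewrite sB' => jd <-.
have /rowP/(_ (Ordinal jd)) := vM; rewrite !mxE => vj; rewrite -[RHS]vj.
by rewrite hE; apply: eq_bigr => l _; rewrite !mxE.
Qed.

End TwoBases.
End Weights.

(** * Monomial orders and their refinement of a weight *)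

Section Orders.
Variables (n : nat).
Implicit Types (m u : multinom n) (lt : rel (multinom n)).

Definition order_le lt : rel (multinom n) := fun u m => (u == m) || lt u m.

Definition compatible (r : rel (multinom n)) :=
  forall u v m, r (mnm_add u m) (mnm_add v m) = r u v.

Lemma order_le_preorder lt : mult_order lt -> total_preorder (order_le lt).
Proof.
move=> [irr tr tot _]; split=> [u m|u m v]; rewrite /order_le.
  rewrite eq_sym; case: eqVneq => //= mu.
  by rewrite orbC; apply: tot.
move=> /predU1P[->//|mu] /predU1P[<-|uv]; first by rewrite mu orbT.
by rewrite (tr _ _ _ mu uv) orbT.
Qed.

Lemma order_le_anti lt u m : mult_order lt ->
  order_le lt u m -> order_le lt m u -> u = m.
Proof.
move=> [irr tr _ _] /predU1P[//|um] /predU1P[//|mu].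
by have := tr _ _ _ um mu; rewrite irr.
Qed.

Lemma order_le_compatible lt : mult_order lt -> compatible (order_le lt).
Proof.
move=> lto u v m; have [irr tr tot cp] := lto; apply/idP/idP; last first.
  by move=> /predU1P[->|uv]; rewrite /order_le ?eqxx// cp ?orbT.
have [//|nuv] := boolP (order_le lt u v).
have vu : lt v u.
  have [tt _] := order_le_preorder lto; have := tt u v; rewrite (negPf nuv) /=.
  by move=> /predU1P[vu|//]; rewrite /order_le vu eqxx in nuv.
move=> uvm; have vum : order_le lt (mnm_add v m) (mnm_add u m).
  by rewrite /order_le cp ?orbT.
have := cp _ _ m vu; rewrite (order_le_anti lto uvm vum).
by rewrite irr.
Qed.

Lemma mult_order_exists : exists lt, mult_order lt.
Proof.
exists (fun u m => (u < m)%O); split.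
- by move=> u; rewrite ltxx.
- by move=> u m v; exact: lt_trans.
- by move=> u v; rewrite neq_lt.
- by move=> u v m; rewrite ltmc_add2l.
Qed.

Section Refinement.
Variables (R : realDomainType) (w : multinom n -> R).

Definition weight_additive := forall u m, w (mnm_add u m) = w u + w m.

Definition refine_order lt : rel (multinom n) :=
  fun u m => (w u < w m) || ((w u == w m) && lt u m).

Lemma refine_order_mult lt :
  weight_additive -> mult_order lt -> mult_order (refine_order lt).
Proof.
move=> wD [irr tr tot cp]; split.
- by move=> u; rewrite /refine_order ltxx irr andbF.
- move=> u m v /orP[mu|/andP[/eqP mu ltmu]] /orP[uv|/andP[/eqP uv ltuv]].
  + by rewrite /refine_order (lt_trans mu uv).
  + by rewrite /refine_order -uv mu.
  + by rewrite /refine_order mu uv.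
  + by rewrite /refine_order mu uv eqxx (tr _ _ _ ltmu ltuv) orbT.
- by move=> u v uv; rewrite /refine_order; case: (ltgtP (w u) (w v)) => //= _; exact: tot.
- move=> u v m; rewrite /refine_order !wD ltrD2r (inj_eq (addIr _)).
  by move=> /orP[->//|/andP[-> /cp ->]]; rewrite orbT.
Qed.

Lemma order_le_refine lt u m :
  order_le (refine_order lt) u m = (w u < w m) || ((w u == w m) && order_le lt u m).
Proof.
rewrite /order_le /refine_order; case: (eqVneq u m) => [->|_]//=.
by rewrite eqxx orbT.
Qed.

Lemma order_le_refine_weight lt u m :
  order_le (refine_order lt) u m -> weight_le w u m.
Proof.
rewrite order_le_refine /weight_le le_eqVlt.
by case/orP => [->|/andP[->]]//; rewrite orbT.
Qed.

Lemma weight_le_compatible : weight_additive -> compatible (weight_le w).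
Proof. by move=> wD u v m; rewrite /weight_le !wD lerD2r. Qed.

End Refinement.

Lemma weight_additiveN (R : realDomainType) (w : multinom n -> R) :
  weight_additive w -> weight_additive (fun m => - w m).
Proof. by move=> wD u m /=; rewrite wD opprD. Qed.

End Orders.

(** * The basis attached to a monomial order *)

Section InitialMonomials.
Variables (k : fieldType) (n : nat).
Implicit Types (f g h : mpoly n k) (L K : set (mpoly n k)) (m u : multinom n).
Implicit Types (lt : rel (multinom n)).

Definition initial_monomials (r : rel (multinom n)) L : set (multinom n) :=
  [set m | exists2 f, L f & leading r f m].

Definition supported (N : seq (multinom n)) L :=
  forall f m, L f -> m \in msupp f -> m \in N.

Lemma leading_mpolyX r m : total_preorder r -> leading r (mpolyX k m) m.
Proof.
move=> pr; rewrite /leading msuppX; split; first exact: mem_head.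
by move=> u; rewrite inE => /eqP ->; exact: total_preorder_refl.
Qed.

(** One division step cancels the leading monomial and creates only smaller
ones. *)
Lemma leading_cancel lt f h m u (c := mcoeff m h / mcoeff m f) : mult_order lt ->
  leading (order_le lt) f m -> leading (order_le lt) h m ->
  u \in msupp (h - c *: f) ->
  (u \in msupp f \/ u \in msupp h) /\ lt u m.
Proof.
move=> lto [mf lf] [mh lh]; rewrite mcoeff_msupp mcoeffB mcoeffZ => hu.
have um : u != m.
  apply: contra_neq hu => ->; rewrite /c mulfVK ?subrr//.
  by rewrite -mcoeff_msupp.
have H : u \in msupp f \/ u \in msupp h.
  have [|fu] := boolP (u \in msupp f); first by left.
  by right; rewrite mcoeff_msupp; move: hu; rewrite (memN_msupp_eq0 fu) mulr0 subr0.
split=> //; have : order_le lt u m by case: H => [/lf|/lh].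
by rewrite /order_le (negPf um).
Qed.

Lemma count_lt (T : eqType) (p q : pred T) (s : seq T) x :
  subpred p q -> x \in s -> q x -> ~~ p x -> (count p s < count q s)%N.
Proof.
move=> pq + qx px; elim: s => //= y s ih; rewrite inE => /predU1P[<-|/ih pqs].
  by rewrite qx (negPf px) add0n add1n ltnS sub_count.
rewrite -addnS leq_add//.
by case: (boolP (p y)) => // /pq ->.
Qed.

(** Division of [h] by [L]. A multiplicative order may have infinite descending
chains; termination comes from the finite support [N], by induction on the number
of elements of [N] below the monomials of [h]. *)
Lemma normal_form_exists N L lt h : lin_closed L -> mult_order lt -> supported N L ->
  {subset msupp h <= N} ->
  exists g, [/\ L g,
    forall m, initial_monomials (order_le lt) L m -> mcoeff m (h - g) = 0
    & forall u, u \in msupp g -> exists2 m, m \in msupp h & order_le lt u m].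
Proof.
move=> sL lto NL; have pr := order_le_preorder lto; have [irr tr tot cp] := lto.
have [_ tr'] := pr.
pose rank u := count (lt^~ u) N.
have rank_lt u m : u \in N -> lt u m -> (rank u < rank m)%N.
  move=> uN um; apply: (count_lt _ uN) => //; last by rewrite irr.
  by move=> v vu; exact: tr vu um.
have [c hc] : exists c, forall u, u \in msupp h -> (rank u < c)%N.
  exists (size N).+1 => u _; exact: count_size.
elim: c h hc => [|c ih] h hc hN.
  have -> : h = 0.
    by apply/msuppnil0; case: (msupp h) hc => // m s /(_ m (mem_head _ _)).
  exists 0; split; first by case: sL.
    by move=> m _; rewrite subr0 mcoeff0.
  by move=> u; rewrite msupp0.
have [->|h0] := eqVneq h 0.
  exists 0; split; first by case: sL.
    by move=> m _; rewrite subr0 mcoeff0.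
  by move=> u; rewrite msupp0.
have [m lm] := leading_exists pr h0; have [mh lh] := lm.
have step f : leading (order_le lt) f m -> {subset msupp f <= N} ->
    exists g, [/\ L g,
      forall u, initial_monomials (order_le lt) L u ->
        mcoeff u (h - (mcoeff m h / mcoeff m f) *: f - g) = 0
      & forall u, u \in msupp g -> exists2 v, v \in msupp h & order_le lt u v].
  move=> lf fN.
  have [||g [Lg g0 gs]] := ih (h - (mcoeff m h / mcoeff m f) *: f).
  - move=> u /(leading_cancel lto lf lm)[ufh um].
    apply: (@leq_trans (rank m)); last by rewrite -ltnS; exact: hc.
    by apply: rank_lt => //; case: ufh => [/fN|/hN].
  - by move=> u /(leading_cancel lto lf lm)[[/fN|/hN]].
  exists g; split=> // u /gs[v /(leading_cancel lto lf lm)[_ vm] uv].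
  by exists m => //; apply: tr' uv _; rewrite /order_le vm orbT.
have [[f Lf lf]|mL] := pselect (initial_monomials (order_le lt) L m).
  have [g [Lg g0 gs]] := step f lf (fun u => NL f u Lf).
  have [_ LD] := sL.
  exists ((mcoeff m h / mcoeff m f) *: f + g); split; first exact: LD.
    by move=> u /g0; rewrite opprD addrA.
  move=> u /msuppD_le; rewrite mem_cat => /orP[/msuppZ_le uf|/gs//].
  by exists m => //; exact: lf.2.
have [||g [Lg g0 gs]] := step (mpolyX k m).
- exact: leading_mpolyX.
- by move=> u; rewrite msuppX inE => /eqP ->; exact: hN.
exists g; split=> // u uL; have := g0 u uL.
rewrite !mcoeffB mcoeffZ !mcoeffX eqxx.
case: (eqVneq m u) => [mu|_]; first by rewrite mu in mL.
by rewrite mulr0 subr0.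
Qed.

(** The remainder of an element of [L] on division by [K] lies in [L], and its
leading monomial could not have survived the division. *)
Lemma eq_from_initial_monomials N L K lt : lin_closed L -> lin_closed K ->
  mult_order lt -> supported N L -> K `<=` L ->
  initial_monomials (order_le lt) L `<=` initial_monomials (order_le lt) K ->
  L = K.
Proof.
move=> sL sK lto NL KL iLK; apply/seteqP; split=> // f Lf.
have NK : supported N K by move=> g m /KL; exact: NL.
have [g [Kg g0 _]] := normal_form_exists sK lto NK (fun m => NL f m Lf).
suff /eqP : f - g = 0 by rewrite subr_eq0 => /eqP ->.
apply/eqP; apply: contraT => /(leading_exists (order_le_preorder lto))[m lm].
suff /g0/eqP : initial_monomials (order_le lt) K m.
  by rewrite mcoeff_eq0 lm.1.
apply: iLK; exists (f - g) => //.
by apply: lin_closedB => //; exact: KL.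
Qed.

Definition initial_seq N L lt : seq (multinom n) :=
  [seq m <- N | `[< initial_monomials (order_le lt) L m >]].

Lemma mem_initial_seq N L lt m : supported N L ->
  m \in initial_seq N L lt <-> initial_monomials (order_le lt) L m.
Proof.
move=> NL; rewrite mem_filter; split=> [/andP[/asboolP//]|mL].
by apply/andP; split; [exact/asboolP | case: mL => f Lf [mf _]; exact: NL Lf mf].
Qed.

(** [F m] is [m] minus its remainder on division by [L]. *)
Lemma initial_dual_family N L lt : uniq N -> lin_closed L -> mult_order lt ->
  supported N L ->
  exists F, dual_family L (initial_seq N L lt) F /\
            adapted (order_le lt) (initial_seq N L lt) F.
Proof.
move=> uN sL lto NL; set B := initial_seq N L lt.
have BN : {subset B <= N} by move=> m; rewrite mem_filter => /andP[].
have [F HF] : {F : multinom n -> mpoly n k & forall m, m \in B -> [/\ L (F m),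
    forall u, initial_monomials (order_le lt) L u ->
      mcoeff u (mpolyX k m - F m) = 0
    & forall u, u \in msupp (F m) -> order_le lt u m]}.
  apply: (@choice _ _ (fun m g => m \in B -> [/\ L g,
    forall u, initial_monomials (order_le lt) L u ->
      mcoeff u (mpolyX k m - g) = 0
    & forall u, u \in msupp g -> order_le lt u m])) => m.
  have [mB|mB] := boolP (m \in B); last by exists 0.
  have [|g [Lg g0 gs]] := @normal_form_exists N L lt (mpolyX k m) sL lto NL.
    by move=> u; rewrite msuppX inE => /eqP ->; exact: BN.
  exists g => _; split=> // u /gs[v].
  by rewrite msuppX inE => /eqP ->.
have dF m u : m \in B -> u \in B -> mcoeff u (F m) = (m == u)%:R.
  move=> mB /mem_initial_seq-/(_ NL) uL.
  have [_ /(_ u uL)/eqP + _] := HF m mB.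
  by rewrite mcoeffB mcoeffX subr_eq0 => /eqP ->.
exists F; split; last by move=> m u mB; have [_ _] := HF m mB; exact.
split=> //; [exact: filter_uniq | by move=> m /HF[] |].
move=> f Lf; apply/eqP; rewrite -subr_eq0; set g := _ - _.
have Lg : L g.
  apply: lin_closedB => //; apply: lin_closed_sum => // m mB.
  by apply: lin_closedZ => //; have [] := HF m mB.
apply: contraT => /(leading_exists (order_le_preorder lto))[u [ug lu]].
have uB : u \in B by apply/mem_initial_seq => //; exists g.
move: ug; rewrite mcoeff_msupp mcoeffB raddf_sum/= (bigD1_seq u) ?filter_uniq//=.
rewrite mcoeffZ dF// eqxx mulr1 big_seq_cond big1 ?addr0 ?subrr ?eqxx//.
by move=> m /andP[mB mu]; rewrite mcoeffZ dF// (negPf mu) mulr0.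
Qed.

End InitialMonomials.

(** * Initial spaces and optimal initial bases *)

Section LocalComparison.
Variables (R : realDomainType) (k : fieldType) (n : nat).
Variables (N : seq (multinom n)) (L : set (mpoly n k)).
Hypotheses (uN : uniq N) (sL : lin_closed L) (NL : supported N L).
Implicit Types (f g h : mpoly n k) (m u : multinom n).
Implicit Types (lt : rel (multinom n)) (w v : multinom n -> R).

Definition optimal w lt := forall lt', mult_order lt' ->
  weight w (initial_seq N L lt') <= weight w (initial_seq N L lt).

Lemma adapted_refine w lt B (F : multinom n -> mpoly n k) :
  adapted (order_le (refine_order w lt)) B F -> adapted (weight_le w) B F.
Proof. by move=> aB m u mB /(aB _ _ mB); exact: order_le_refine_weight. Qed.

Lemma refine_optimal w lt :
  weight_additive w -> mult_order lt -> optimal w (refine_order w lt).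
Proof.
move=> wD lto lt' lto'; have rlto := refine_order_mult wD lto.
have [F [bF /adapted_refine aF]] := initial_dual_family uN sL rlto NL.
have [F' [bF' _]] := initial_dual_family uN sL lto' NL.
exact: weight_le_adapted bF aF bF'.
Qed.

(** Optimality among initial bases is optimality among all bases of [L], because
refining [w] by a monomial order produces an initial basis adapted to [w]. *)
Lemma optimalP w lt : weight_additive w -> mult_order lt ->
  optimal w lt <-> (forall h, init_space (weight_le w) L h ->
    (forall m, m \in initial_seq N L lt -> mcoeff m h = 0) -> h = 0).
Proof.
move=> wD lto; have rlto := refine_order_mult wD lto.
have [F [bF /adapted_refine aF]] := initial_dual_family uN sL rlto NL.
have [F' [bF' _]] := initial_dual_family uN sL lto NL.
have [eq1 eq2] := weight_eq_adapted bF aF bF'.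
split=> [opt|H].
  apply: eq1; apply/eqP.
  by rewrite eq_le opt// andbT refine_optimal.
move=> lt' lto'; rewrite (eq2 H); exact: refine_optimal.
Qed.

Lemma optimal_init_space v w lt : weight_additive v -> weight_additive w ->
  mult_order lt -> init_space (weight_le v) L = init_space (weight_le w) L ->
  optimal v lt -> optimal w lt.
Proof. by move=> vD wD lto e /optimalP-/(_ vD lto); rewrite e => /optimalP; exact. Qed.

(** If the initial form of [F m] missed [m], it would be a nonzero initial form
vanishing on the whole basis. *)
Lemma optimal_adapted w lt (F : multinom n -> mpoly n k)
    (B := initial_seq N L lt) : weight_additive w ->
  mult_order lt -> optimal w lt -> dual_family L B F ->
  adapted (weight_le w) B F.
Proof.
move=> wD lto /optimalP-/(_ wD lto) H bF m u mB uF.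
have pr := weight_le_preorder w.
have [uB LB dB eB] := bF.
have Fm0 : F m != 0 by rewrite -msupp_eq0; apply: contraTneq uF => ->.
have [m0 lm0] := leading_exists pr Fm0.
have iE x := mcoeff_init_form x pr lm0.
have [m0m|nm0m] := boolP (weight_le w m0 m); first by apply: le_trans m0m; exact: lm0.2.
suff i0 : init_form (weight_le w) (F m) = 0 by case/eqP: Fm0; exact: init_form_eq0 pr i0.
apply: H; first by apply: sub_linspan; exists (F m) => //; exact: LB.
move=> x xB; rewrite iE dB//; case: (eqVneq m x) => [<-|_]; last by rewrite if_same.
by rewrite (negPf nm0m).
Qed.

(** The family comes from the order that compares by [v] and then by [-w]: for
terms tied with [m] under [v] it gives [w u >= w m], while optimality for [w] gives
[w u <= w m]. *)
Lemma joint_family v w : weight_additive v -> weight_additive w ->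
  (forall lt, mult_order lt -> optimal v lt -> optimal w lt) ->
  exists B F, [/\ dual_family L B F, adapted (weight_le v) B F,
    adapted (weight_le w) B F
    & forall m u, m \in B -> u \in msupp (F m) -> v u = v m -> w u = w m].
Proof.
move=> vD wD vw; have [lt0 lto0] := mult_order_exists n.
have wND := weight_additiveN wD.
have lto1 := refine_order_mult wND lto0; have lto := refine_order_mult vD lto1.
have opt : optimal v (refine_order v (refine_order (fun m => - w m) lt0)).
  exact: refine_optimal.
have [F [bF aF]] := initial_dual_family uN sL lto NL.
have aw := optimal_adapted wD lto (vw _ lto opt) bF.
exists (initial_seq N L (refine_order v (refine_order (fun m => - w m) lt0))), F.
split=> //.
  exact: adapted_refine aF.
move=> m u mB uF vE; apply/eqP; rewrite eq_le; have := aw _ _ mB uF.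
rewrite {1}/weight_le => ->.
have := aF _ _ mB uF; rewrite order_le_refine vE ltxx eqxx /=.
by move=> /order_le_refine_weight; rewrite /weight_le lerN2.
Qed.

(** The family for [(w, v)] shows that the space of [w]-initial forms is graded
by [v]; the family for [(v, w)] shows that each generator of the space of
[v]-initial forms is a [v]-component of a [w]-initial form. *)
Lemma init_space_sub v w : weight_additive v -> weight_additive w ->
  (forall lt, mult_order lt -> optimal v lt <-> optimal w lt) ->
  init_space (weight_le v) L `<=` init_space (weight_le w) L.
Proof.
move=> vD wD vw; have pv := weight_le_preorder v; have pw := weight_le_preorder w.
have [B [F [bF av aw vEw]]] := joint_family vD wD (fun lt lto => (vw lt lto).1).
have [B' [F' [bF' aw' av' wEv]]] := joint_family wD vD (fun lt lto => (vw lt lto).2).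
have graded c h : init_space (weight_le w) L h ->
    init_space (weight_le w) L (sub_poly (fun u => v u == c) h).
  have bI := dual_family_init_form pw bF' aw'; have [_ IB _ eI] := bI => Lh.
  set K := init_space (weight_le w) L in Lh eI IB *.
  have cK : lin_closed K by exact: lin_closed_linspan.
  have cS : lin_closed [set g | K (sub_poly (fun u => v u == c) g)].
    split=> [|a f g] /=; first by rewrite sub_poly0; case: cK.
    by rewrite sub_poly_linear; case: cK => _; exact.
  rewrite (eI h Lh); apply: (lin_closed_sum cS) => m mB.
  apply: (lin_closedZ _ cS) => /=.
  have vE u : u \in msupp (init_form (weight_le w) (F' m)) -> v u = v m.
    rewrite mcoeff_msupp (mcoeff_init_form _ pw (adapted_leading bF' aw' mB)).
    case: ifP => [mu|]; last by rewrite eqxx.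
    rewrite -mcoeff_msupp => uF; apply: wEv => //.
    by apply/eqP; rewrite eq_le; apply/andP; split=> //; exact: aw' _ _ mB uF.
  have [vm|vm] := eqVneq (v m) c.
    rewrite sub_poly_all; first exact: IB mB.
    by move=> u /vE ->; rewrite vm.
  rewrite sub_poly_none; first by case: cK.
  by move=> u /vE ->.
have bI := dual_family_init_form pv bF av; have [_ _ _ eI] := bI.
have cK : lin_closed (init_space (weight_le w) L) by exact: lin_closed_linspan.
move=> h Lh; rewrite (eI h Lh); apply: (lin_closed_sum cK) => m mB.
apply: (lin_closedZ _ cK) => /=.
suff -> : init_form (weight_le v) (F m) =
    sub_poly (fun u => v u == v m) (init_form (weight_le w) (F m)).
  apply: graded; apply: sub_linspan; exists (F m) => //.
  by have [_ LF _ _] := bF; exact: LF.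
apply/mpolyP => u; rewrite mcoeff_sub_poly.
rewrite (mcoeff_init_form _ pv (adapted_leading bF av mB)).
rewrite (mcoeff_init_form _ pw (adapted_leading bF aw mB)).
have [->|] := eqVneq (mcoeff u (F m)) 0; first by rewrite !if_same.
rewrite -mcoeff_msupp => uF.
have vum : v u <= v m by exact: av _ _ mB uF.
rewrite eq_le vum /= [weight_le v m u]/weight_le; case: ifP => // vmu.
have vE : v u = v m by apply/eqP; rewrite eq_le vum.
by rewrite /weight_le (vEw _ _ mB uF vE) lexx.
Qed.

Lemma init_space_eqP v w : weight_additive v -> weight_additive w ->
  init_space (weight_le v) L = init_space (weight_le w) L <->
  (forall lt, mult_order lt -> optimal v lt <-> optimal w lt).
Proof.
move=> vD wD; split=> [e lt lto|vw].
  by split; [exact: (@optimal_init_space v w) | exact: (@optimal_init_space w v)].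
apply/seteqP; split; first exact: init_space_sub.
by apply: init_space_sub => // lt lto; split=> /(vw lt lto).
Qed.

(** Taking initial forms for [w] and then for [lt] amounts to taking them for
the refinement of [w] by [lt]. *)
Lemma initial_monomials_init_space w lt : weight_additive w -> mult_order lt ->
  initial_monomials (order_le lt) (init_space (weight_le w) L) `<=`
  initial_monomials (order_le (refine_order w lt)) L.
Proof.
move=> wD lto m [h Lh [mh lh]]; have rlto := refine_order_mult wD lto.
have [F [bF aF]] := initial_dual_family uN sL rlto NL.
have pw := weight_le_preorder w; have aw := adapted_refine aF.
have bI := dual_family_init_form pw bF aw.
have : has (fun u => (mcoeff u h != 0) &&
    (mcoeff m (init_form (weight_le w) (F u)) != 0))
    (initial_seq N L (refine_order w lt)).
  apply: contraLR mh => /hasPn noB; rewrite -mcoeff_eq0 (mcoeff_dual_family m bI Lh).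
  rewrite big_seq big1// => u /noB; rewrite negb_and !negbK => /orP[]/eqP.
    by move=> ->; rewrite mul0r.
  by move=> /= ->; rewrite mulr0.
move=> /hasP[u uB]; rewrite -mcoeff_msupp => /andP[/lh um].
rewrite (mcoeff_init_form _ pw (adapted_leading bF aw uB)).
case: ifP => [uwm|]; last by rewrite eqxx.
rewrite -mcoeff_msupp => mF; suff -> : m = u by apply/(mem_initial_seq _ _ NL).
apply: order_le_anti lto _ um; have := aF _ _ uB mF.
rewrite order_le_refine; case/orP => [mwu|/andP[]//].
by move: uwm; rewrite /weight_le leNgt mwu.
Qed.

End LocalComparison.

(** * Initial ideals, degree by degree *)

Section Ideals.
Variables (k : fieldType) (n : nat).
Implicit Types (f g h : mpoly n k) (I J L : set (mpoly n k)).
Implicit Types (m u : multinom n) (r : rel (multinom n)) (lt : rel (multinom n)).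

Definition init_ideal r I : set (mpoly n k) := ideal_gen (init_form r @` (I `\ 0)).

Lemma is_ideal_lin_closed J : is_ideal J -> lin_closed J.
Proof.
move=> [J0 JD JM]; split=> // c f g Jf Jg; apply: JD => //.
by rewrite -mul_mpolyC; exact: JM.
Qed.

Lemma is_ideal_mulX J : lin_closed J ->
  (forall f u, J f -> J (f * mpolyX k u)) -> is_ideal J.
Proof.
move=> sJ JX; split; first by case: sJ.
  by move=> f g; exact: lin_closedD.
move=> h f Jf; rewrite [h]mpolyE mulr_suml; apply: (lin_closed_sum sJ) => u _.
rewrite -scalerAl; apply: (lin_closedZ _ sJ).
by rewrite mulrC; exact: JX.
Qed.

Lemma ideal_gen_ideal (V : set (mpoly n k)) : is_ideal (ideal_gen V).
Proof.
split; first by move=> J [[]].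
- move=> f g If Ig J [iJ VJ]; have [_ JD _] := iJ.
  by apply: JD; [exact: If | exact: Ig].
- move=> h f If J [iJ VJ]; have [_ _ JM] := iJ.
  by apply: JM; exact: If.
Qed.

Lemma ideal_gen_sub (V J : set (mpoly n k)) :
  is_ideal J -> V `<=` J -> ideal_gen V `<=` J.
Proof. exact: smallest_sub. Qed.

Lemma init_form_mem_ideal r I f :
  total_preorder r -> I f -> init_ideal r I (init_form r f).
Proof.
move=> pr If; have [->|f0] := eqVneq f 0.
  by rewrite init_form0; have [] := ideal_gen_ideal (init_form r @` (I `\ 0)).
apply: sub_gen_smallest; exists f => //; split=> //.
by move=> /eqP; rewrite (negPf f0).
Qed.

Lemma mem_msupp_mulX f u m :
  m \in msupp (f * mpolyX k u) -> exists2 m', m' \in msupp f & m = mnm_add u m'.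
Proof. by rewrite (perm_mem (msuppMX _ _)) => /mapP[m' m'f ->]; exists m'. Qed.

Lemma sub_poly_mulX p f u : sub_poly p (f * mpolyX k u) =
  sub_poly (fun m => p (mnm_add u m)) f * mpolyX k u.
Proof.
rewrite /sub_poly (perm_big _ (msuppMX _ _)) big_map mulr_suml.
apply: eq_bigr => m _.
by rewrite mcoeffMX -scalerAl [mnm_add u m]addmC mpolyXD.
Qed.

Lemma init_form_mulX r f u : compatible r ->
  init_form r (f * mpolyX k u) = init_form r f * mpolyX k u.
Proof.
move=> cr; rewrite /init_form sub_poly_mulX; congr (_ * _).
apply: eq_bigl => m; rewrite (perm_all _ (msuppMX _ _)) all_map.
by apply: eq_all => v /=; rewrite ![mnm_add u _]addmC cr.
Qed.

Lemma msupp_init_formE r f m : m \in msupp (init_form r f) <-> leading r f m.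
Proof.
rewrite mcoeff_msupp mcoeff_sub_poly /leading; split.
  case: ifP => [/allP fm|]; last by rewrite eqxx.
  by rewrite -mcoeff_msupp.
move=> [mf lf]; rewrite ifT -?mcoeff_msupp//.
by apply/allP => u /lf.
Qed.

Lemma leading_mulX r f m u : compatible r ->
  leading r f m -> leading r (f * mpolyX k u) (mnm_add u m).
Proof.
move=> cr [mf lf]; split.
  by rewrite (perm_mem (msuppMX _ _)); apply/mapP; exists m.
by move=> _ /mem_msupp_mulX[v vf ->]; rewrite ![mnm_add u _]addmC cr; exact: lf.
Qed.

Lemma leading_init_form (R : realDomainType) (w : multinom n -> R) lt f m :
  leading (order_le (refine_order w lt)) f m ->
  leading (order_le lt) (init_form (weight_le w) f) m.
Proof.
move=> [mf lf]; split.
  by apply/msupp_init_formE; split=> // u /lf; exact: order_le_refine_weight.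
move=> u /msupp_init_formE[uf /(_ _ mf) mu]; have := lf u uf.
rewrite order_le_refine => /orP[um|/andP[]//].
by move: mu; rewrite /weight_le leNgt um.
Qed.

(** In an ideal generated by monomials up to scalars, each monomial of an element
is a multiple of a generator. *)
Lemma mem_msupp_initial_ideal lt (G : set (mpoly n k)) h m : mult_order lt ->
  ideal_gen (init_form (order_le lt) @` (G `\ 0)) h -> m \in msupp h ->
  exists g u m', [/\ (G `\ 0) g, leading (order_le lt) g m' & m = mnm_add u m'].
Proof.
move=> lto; move: h m.
pose J := [set h : mpoly n k | forall m, m \in msupp h -> exists g u m',
  [/\ (G `\ 0) g, leading (order_le lt) g m' & m = mnm_add u m']].
suff : ideal_gen (init_form (order_le lt) @` (G `\ 0)) `<=` J.
  by move=> GJ h m /GJ hJ; exact: hJ.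
apply: ideal_gen_sub; first apply: is_ideal_mulX.
- split=> [m|c f g Jf Jg m]; first by rewrite msupp0.
  by move=> /msuppD_le; rewrite mem_cat => /orP[/msuppZ_le/Jf|/Jg].
- move=> f u Jf _ /mem_msupp_mulX[m /Jf[g [v [m' [Gg lg ->]]]] ->].
  by exists g, (mnm_add u v), m'; split=> //; rewrite addmA.
move=> _ [g Gg <-] m /msupp_init_formE lm; exists g, (@mnm0 n), m; split=> //.
by rewrite add0m.
Qed.

Section Grading.
Variables (A : zmodType) (a : 'I_n -> A).

Definition piece J s : set (mpoly n k) := J `&` graded_piece a s.

Lemma mdegAD u m : mdegA a (mnm_add u m) = mdegA a u + mdegA a m.
Proof.
rewrite /mdegA -big_split /=; apply: eq_bigr => i _.
by rewrite mnmDE mulrnDr.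
Qed.

Lemma graded_piece_lin_closed s : lin_closed (@graded_piece k n A a s).
Proof.
split=> [m|c f g fs gs m]; first by rewrite msupp0.
by move=> /msuppD_le; rewrite mem_cat => /orP[/msuppZ_le/fs|/gs].
Qed.

Lemma piece_lin_closed J s : lin_closed J -> lin_closed (piece J s).
Proof.
move=> [J0 JD]; have [g0 gD] := graded_piece_lin_closed s.
by split=> // c f g [Jf fs] [Jg gs]; split; [exact: JD|exact: gD].
Qed.

Lemma graded_piece_mulX f u s : graded_piece a s f ->
  graded_piece a (mdegA a u + s) (f * mpolyX k u).
Proof. by move=> fs _ /mem_msupp_mulX[m /fs <- ->]; rewrite mdegAD. Qed.

Definition component s f := sub_poly (fun m => mdegA a m == s) f.

Lemma graded_component s f : graded_piece a s (component s f).
Proof.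
by move=> m; rewrite mcoeff_msupp mcoeff_sub_poly; case: ifP => [/eqP|]; rewrite ?eqxx.
Qed.

Lemma component_graded s t f : graded_piece a t f ->
  component s f = if s == t then f else 0.
Proof.
move=> ft; case: eqP => [->|st]; [apply: sub_poly_all | apply: sub_poly_none].
  by move=> m /ft ->.
by move=> m /ft ->; rewrite eq_sym; exact/eqP.
Qed.

Lemma component_sum (T : Type) (l : seq T) (g : T -> mpoly n k) s :
  component s (\sum_(t <- l) g t) = \sum_(t <- l) component s (g t).
Proof.
elim: l => [|t l ih]; first by rewrite !big_nil /component sub_poly0.
rewrite !big_cons -ih -[g t]scale1r /component sub_poly_linear.
by rewrite !scale1r.
Qed.

Lemma component_homogeneous I s f :
  homogeneous_ideal a I -> I f -> I (component s f).
Proof.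
move=> [iI tI]; rewrite {1}tI => -[l [g [ul gl ->]]].
have sI := is_ideal_lin_closed iI.
rewrite component_sum; apply: (lin_closed_sum sI) => t /gl[_ [It gt]].
by rewrite (component_graded _ gt); case: eqP => // _; case: iI.
Qed.

Lemma truncation_piece Om J s : J 0 -> Om s ->
  truncation a Om J `&` graded_piece a s = piece J s.
Proof.
move=> J0 Oms; apply/seteqP; split=> f [Jf fs]; last first.
  split=> //; exists [:: s], (fun=> f); split=> //; last by rewrite big_seq1.
  by move=> t; rewrite inE => /eqP ->.
split=> //; have [l [g [ul gl fE]]] := Jf.
have gE t : t \in l -> component s (g t) = if s == t then g t else 0.
  move=> /gl[_ [_ gt]]; rewrite (component_graded _ gt).
  by case: eqP => // ->.
have -> : f = \sum_(t <- l) component s (g t).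
  by rewrite -component_sum -fE (component_graded _ fs) eqxx.
rewrite big_seq (eq_bigr _ gE) -big_seq.
have [sl|sl] := boolP (s \in l); last first.
  by rewrite big_seq big1// => t tl; case: eqP => // st; rewrite st tl in sl.
rewrite (bigD1_seq s)//= eqxx big1 ?addr0; last first.
  by move=> t ts; rewrite eq_sym (negPf ts).
by have [_ []] := gl s sl.
Qed.

Lemma truncation_eqP Om J J' : J 0 -> J' 0 ->
  truncation a Om J = truncation a Om J' <->
  (forall s, Om s -> piece J s = piece J' s).
Proof.
move=> J0 J'0; split=> [e s Oms|e].
  by rewrite -!(truncation_piece _ Oms)// e.
apply/seteqP; split=> _ [l [g [ul gl ->]]]; exists l, g; split=> // s /gl[Oms gs].
  by split=> //; have := e s Oms; rewrite /piece => <-.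
by split=> //; have := e s Oms; rewrite /piece => ->.
Qed.

(** Polynomials all of whose components are sums of initial forms of homogeneous
elements of [I] form an ideal; it contains the initial form of every [f] in [I],
since a component of that initial form is either zero or the initial form of the
same component of [f]. *)
Lemma init_ideal_piece r I s : total_preorder r -> compatible r ->
  homogeneous_ideal a I ->
  piece (init_ideal r I) s = init_space r (piece I s).
Proof.
move=> pr cr hI; have [iI _] := hI.
apply/seteqP; split; last first.
  apply: linspan_sub.
    by apply: piece_lin_closed; apply: is_ideal_lin_closed; exact: ideal_gen_ideal.
  move=> _ [f [If fs] <-]; split; first exact: init_form_mem_ideal.
  by move=> m /msupp_init_formE[/fs].
pose J := [set h : mpoly n k | forall t, init_space r (piece I t) (component t h)].
have cI t : lin_closed (init_space r (piece I t)) by exact: lin_closed_linspan.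
suff JI : init_ideal r I `<=` J.
  by move=> h [/JI/(_ s) + hs]; rewrite (component_graded _ hs) eqxx.
apply: ideal_gen_sub; first apply: is_ideal_mulX.
- split=> [t|c f g Jf Jg t].
    by rewrite /component sub_poly0; case: (cI t).
  rewrite /component sub_poly_linear.
  by case: (cI t) => _; apply; [exact: Jf | exact: Jg].
- move=> f u Jf t.
  rewrite /component sub_poly_mulX.
  have -> : sub_poly (fun m => mdegA a (mnm_add u m) == t) f =
            component (t - mdegA a u) f.
    by apply: eq_bigl => m; rewrite mdegAD [RHS]eq_sym subr_eq addrC eq_sym.
  move: (Jf (t - mdegA a u)); set h := component _ _.
  set t' := t - _ => Jh.
  have -> : t = mdegA a u + t' by rewrite /t' addrC subrK.
  pose H := [set h : mpoly n k |
    init_space r (piece I (mdegA a u + t')) (h * mpolyX k u)].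
  suff : init_space r (piece I t') `<=` H by apply.
  have cH : lin_closed (init_space r (piece I (mdegA a u + t'))).
    exact: lin_closed_linspan.
  apply: linspan_sub.
    split; first by rewrite /H /= mul0r; case: cH.
    by move=> c g1 g2 H1 H2; rewrite /H /= mulrDl -scalerAl; case: cH => _; exact.
  move=> _ [g [Ig gt] <-]; apply: sub_linspan; exists (g * mpolyX k u).
    split; last exact: graded_piece_mulX.
    by rewrite mulrC; case: iI => _ _; exact.
  exact: init_form_mulX.
move=> _ [f [If _] <-] t.
have [[m [lm mt]]|noM] := pselect (exists m, leading r f m /\ mdegA a m = t); last first.
  rewrite /component sub_poly_none; first by case: (cI t).
  by move=> m /msupp_init_formE lm; apply/eqP => mt; apply: noM; exists m.
have lc : leading r (component t f) m.
  have [mf lf] := lm; split.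
    by rewrite mcoeff_msupp mcoeff_sub_poly mt eqxx -mcoeff_msupp.
  move=> u; rewrite mcoeff_msupp mcoeff_sub_poly.
  by case: ifP; rewrite ?eqxx// -mcoeff_msupp => _ /lf.
apply: sub_linspan; exists (component t f).
  by split; [exact: component_homogeneous | exact: graded_component].
apply/mpolyP => u; rewrite (mcoeff_init_form _ pr lc) [in RHS]mcoeff_sub_poly.
by rewrite (mcoeff_init_form _ pr lm) mcoeff_sub_poly; case: ifP; case: ifP.
Qed.

End Grading.
End Ideals.

(** * Finiteness of the graded pieces *)

(** The positions where [u] attains the minimum of a tail. *)
Lemma nondecreasing_subsequence (u : nat -> nat) : exists phi : nat -> nat,
  {homo phi : i j / (i < j)%N} /\ {homo u \o phi : i j / (i <= j)%N}.
Proof.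
have tail_min N : exists i, (N <= i)%N /\ forall j, (N <= j)%N -> (u i <= u j)%N.
  have ex : exists v, `[< exists i, (N <= i)%N /\ u i = v >].
    by exists (u N); apply/asboolP; exists N.
  case: (ex_minnP ex) => v /asboolP[i [Ni uiv]] vmin.
  exists i; split=> // j Nj; rewrite uiv; apply: vmin.
  by apply/asboolP; exists j.
have [g gP] := choice tail_min.
pose phi i := iter i (fun x => g x.+1) (g 0%N).
have phiS i : (phi i < phi i.+1)%N by have [] := gP (phi i).+1.
exists phi; split; first exact: (homo_ltn ltn_trans).
apply: (homo_leq leqnn leq_trans) => i /=.
have H j : (phi i <= j)%N -> (u (phi i) <= u j)%N.
  case: i => [|i] ij /=; first by have [_] := gP 0%N; apply.
  have [+ H] := gP (phi i).+1; move=> le1; apply: H.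
  exact: leq_trans le1 ij.
by apply: H; exact: ltnW.
Qed.

(** Pass to a subsequence that is nondecreasing in one more coordinate, for each
coordinate in turn. *)
Lemma dickson n (m : nat -> multinom n) :
  exists i j, (i < j)%N /\ forall l, (m i l <= m j l)%N.
Proof.
suff [phi [phil phim]] : exists phi : nat -> nat, {homo phi : i j / (i < j)%N} /\
    forall l, l \in enum 'I_n -> {homo (fun i => m (phi i) l) : i j / (i <= j)%N}.
  exists (phi 0%N), (phi 1%N); split; first exact: phil.
  by move=> l; apply: phim; rewrite ?mem_enum.
elim: (enum 'I_n) => [|l s [phi [phil phim]]]; first by exists id; split.
have [psi [psil psim]] := nondecreasing_subsequence (fun i => m (phi i) l).
have psile : {homo psi : i j / (i <= j)%N} by exact: ltnW_homo.
exists (phi \o psi); split; first by move=> i j /psil/phil.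
move=> l'; rewrite inE => /predU1P[->//|/phim l'm] i j /psile.
exact: l'm.
Qed.

Section Degrees.
Variables (k : fieldType) (n : nat) (A : zmodType) (a : 'I_n -> A).
Hypothesis a_pos : positively_graded k a.
Implicit Types (f g h : mpoly n k) (I J L : set (mpoly n k)).
Implicit Types (m u : multinom n) (r : rel (multinom n)) (lt : rel (multinom n)).

Lemma positively_graded_deg0 m : mdegA a m = 0 -> m = @mnm0 n.
Proof.
move=> m0; have : @graded_piece k n A a 0 (mpolyX k m).
  by move=> u; rewrite msuppX inE => /eqP ->.
rewrite a_pos => -[c _ cE].
have := congr1 (mcoeff m) cE; rewrite mcoeffC mcoeffX eqxx.
by case: eqP => // _ /eqP; rewrite mulr0 eq_sym oner_eq0.
Qed.

(** Two comparable monomials of the same degree differ by a monomial of degree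
zero, so they are equal; an infinite set would contradict [dickson]. *)
Lemma finite_degree s : finite_set [set m | mdegA a m = s].
Proof.
apply: contrapT => /infiniteP/card_leP[f].
pose e i : multinom n := val (f (SigSub (mem_set (I : [set: nat] i)))).
have eI : injective e.
  move=> i j /val_inj/inj; rewrite !in_setT => /(_ isT isT).
  by move=> /(congr1 val).
have es i : mdegA a (e i) = s.
  exact: (set_mem (valP (f (SigSub (mem_set (I : [set: nat] i)))))).
have [i [j [ij le]]] := dickson e.
have [d eE] : exists d, e j = mnm_add d (e i).
  by exists (mnm_sub (e j) (e i)); apply/mnmP => l; rewrite mnmDE mnmBE subnK.
suff /eI ji : e j = e i by rewrite ji ltnn in ij.
rewrite eE (positively_graded_deg0 (m := d)) ?add0m//.
have := es j; rewrite eE mdegAD es => /eqP.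
by rewrite -subr_eq0 addrK => /eqP.
Qed.

Lemma degree_seq s : exists2 N : seq (multinom n),
  uniq N & forall m, (m \in N) = (mdegA a m == s).
Proof.
have /finite_seqP[N NE] := finite_degree s.
exists (undup N); first exact: undup_uniq.
move=> m; rewrite mem_undup; apply/idP/eqP => [mN|ms].
  by have : [set` N] m by []; rewrite -NE.
by have : [set m | mdegA a m = s] m by []; rewrite NE.
Qed.

Lemma piece_supported N J s : (forall m, (m \in N) = (mdegA a m == s)) ->
  supported N (piece a J s).
Proof. by move=> NE f m [_ fs] /fs ms; rewrite NE ms. Qed.

(** * Comparison of initial ideals through a universal Groebner basis *)

Lemma initial_monomials_piece lt I s m : mult_order lt -> homogeneous_ideal a I ->
  piece a (init_ideal (order_le lt) I) s (mpolyX k m) <->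
  initial_monomials (order_le lt) (piece a I s) m.
Proof.
move=> lto hI; have pr := order_le_preorder lto.
rewrite init_ideal_piece//; last exact: order_le_compatible.
split=> [|[f If lf]].
  pose J := [set h : mpoly n k | forall m, m \in msupp h ->
    initial_monomials (order_le lt) (piece a I s) m].
  suff JI : init_space (order_le lt) (piece a I s) `<=` J.
    by move=> /JI; apply; rewrite msuppX mem_head.
  apply: linspan_sub.
    split=> [u|c f g Jf Jg u]; first by rewrite msupp0.
    by move=> /msuppD_le; rewrite mem_cat => /orP[/msuppZ_le/Jf|/Jg].
  by move=> _ [f If <-] u /msupp_init_formE lu; exists f.
have fm : mcoeff m f != 0 by rewrite -mcoeff_msupp; case: lf.
have -> : mpolyX k m = (mcoeff m f)^-1 *: init_form (order_le lt) f.
  apply/mpolyP => u; rewrite mcoeffX mcoeffZ (mcoeff_init_form _ pr lf).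
  have [<-|mu] := eqVneq m u; first by rewrite total_preorder_refl// mulVf.
  case: ifP => [lmu|_]; last by rewrite mulr0.
  have [|uf] := boolP (u \in msupp f); last by rewrite (memN_msupp_eq0 uf) mulr0.
  by move=> /(lf.2)/(order_le_anti lto lmu) muE; rewrite muE eqxx in mu.
apply: (lin_closedZ _ (@lin_closed_linspan _ _ _)).
by apply: sub_linspan; exists f.
Qed.

(** With the piece of the intersection of the two initial ideals as the smaller
space, [eq_from_initial_monomials] leaves only leading monomials to compare.
A leading monomial of the piece of the [v]-initial ideal is a multiple of the
leading monomial of some [g] in [G], and the same multiple of the [v]-initial form
of [g] lies in both ideals, because the degree of [g] is in [Om]. *)
Lemma init_piece_extend (R : realDomainType) I (G : set (mpoly n k)) (Om : set A)
    (v w : multinom n -> R) :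
  weight_additive v -> weight_additive w ->
  homogeneous_ideal a I -> truncating a Om -> universal_grobner_basis I G ->
  (forall g, G g -> exists s : A, graded_piece a s g) ->
  (forall s, (Om `&` degrees a G) s ->
     piece a (init_ideal (weight_le v) I) s =
     piece a (init_ideal (weight_le w) I) s) ->
  forall s, Om s ->
     piece a (init_ideal (weight_le v) I) s `<=`
     piece a (init_ideal (weight_le w) I) s.
Proof.
move=> vD wD hI [OmS Omt] [_ GI GB] Gh e s Oms.
have [lt0 lto0] := mult_order_exists n; have lto := refine_order_mult vD lto0.
have pv := weight_le_preorder v; have cv := weight_le_compatible vD.
set Jv := init_ideal (weight_le v) I; set Jw := init_ideal (weight_le w) I.
have cJv : lin_closed Jv by exact/is_ideal_lin_closed/ideal_gen_ideal.
have cJw : lin_closed Jw by exact/is_ideal_lin_closed/ideal_gen_ideal.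
have [N uN NE] := degree_seq s.
suff -> : piece a Jv s = piece a Jv s `&` Jw by move=> f [[_ ?] ?].
apply: (@eq_from_initial_monomials _ _ N _ _ lt0) => //.
- exact: piece_lin_closed.
- have [p0 pD] := piece_lin_closed a s cJv; have [w0 wD'] := cJw.
  by split=> // c f g [fs fw] [gs gw]; split; [exact: pD | exact: wD'].
- exact: piece_supported.
have LE : piece a Jv s = init_space (weight_le v) (piece a I s).
  exact: init_ideal_piece.
move=> m; rewrite {1}LE.
have [I0 ID] : lin_closed I by case: hI => /is_ideal_lin_closed.
have pIs := piece_supported (J := I) NE.
move=> /(initial_monomials_init_space uN (piece_lin_closed _ _ (conj I0 ID)) pIs vD lto0).
move=> /(initial_monomials_piece _ _ lto hI)[].
rewrite -[init_ideal _ _]/(in_ord_ideal (refine_order v lt0) I) -GB// => Xm ms.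
have ms' : mdegA a m = s by apply: ms; rewrite msuppX mem_head.
have [|g [u [m' [[Gg g0] lg mE]]]] := mem_msupp_initial_ideal lto Xm (m := m).
  by rewrite msuppX mem_head.
have [t gt] := Gh g Gg.
have m't : mdegA a m' = t by apply: gt; case: lg.
have sE : s = t + mdegA a u by rewrite -ms' mE mdegAD m't addrC.
have Omt' : Om t.
  apply: (Omt t (mdegA a u) _ _ _).1; last by rewrite -sE.
    by exists m'.
  by exists u.
have lm := leading_init_form lg.
have Pg : piece a Jv t (init_form (weight_le v) g).
  split; first exact: init_form_mem_ideal (GI _ Gg).
  by move=> x /msupp_init_formE[/gt].
have [Pg1 Pg2] := Pg.
have Jg : Jw (init_form (weight_le v) g).
  have : (Om `&` degrees a G) t by split=> //; exists g.
  by move=> /e; rewrite -/Jv -/Jw => E; move: Pg; rewrite E => -[].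
exists (init_form (weight_le v) g * mpolyX k u).
  have mulX (V : set (mpoly n k)) h : ideal_gen V h -> ideal_gen V (h * mpolyX k u).
    by rewrite mulrC; have [_ _] := ideal_gen_ideal V; exact.
  split; last exact: mulX.
  split; first exact: mulX.
  by rewrite sE addrC; exact: graded_piece_mulX.
by rewrite mE; apply: leading_mulX => //; exact: order_le_compatible.
Qed.

End Degrees.

(** * Faces and Minkowski sums of polytopes *)

Section Polytopes.
Variables (R : realType) (n : nat).
Implicit Types (u v w x y p q : 'rV[R]_n) (P Q V W C : set 'rV[R]_n).

Lemma dotvDr w x y : dotv w (x + y) = dotv w x + dotv w y.
Proof.
by rewrite /dotv -big_split /=; apply: eq_bigr => i _; rewrite mxE mulrDr.
Qed.

Lemma dotvZr w s x : dotv w (s *: x) = s * dotv w x.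
Proof. by rewrite /dotv mulr_sumr; apply: eq_bigr => i _; rewrite mxE mulrCA. Qed.

Lemma dotv_sum w (T : Type) (l : seq T) (F : T -> 'rV[R]_n) :
  dotv w (\sum_(i <- l) F i) = \sum_(i <- l) dotv w (F i).
Proof.
elim: l => [|i l ih]; last by rewrite !big_cons dotvDr ih.
by rewrite !big_nil /dotv big1// => i _; rewrite mxE mulr0.
Qed.

Lemma convex_setE C : @convex_set R 'rV[R]_n C <->
  forall x y (s t : R), 0 < s -> 0 < t -> s + t = 1 -> C x -> C y ->
    C (s *: x + t *: y).
Proof.
split=> [cC x y s t s0 t0 st Cx Cy|H].
  have s1 : s <= 1 by rewrite -st lerDl ltW.
  have := cC x y (Itv01 (ltW s0) s1) (mem_set Cx) (mem_set Cy).
  rewrite inE /conv /=.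
  have -> : t = 1 - s by rewrite -st addrC addKr.
  by [].
apply/convex_setW => x y; rewrite !inE => Cx Cy l l0 l1.
rewrite inE; apply: H => //; first by rewrite subr_gt0.
by rewrite addrC subrK.
Qed.

Lemma convex_conv_hull V : @convex_set R 'rV[R]_n (conv_hull V).
Proof.
apply/convex_setE => x y s t s0 t0 st Cx Cy C [cC VC].
by apply: ((convex_setE C).1 cC) => //; [exact: Cx | exact: Cy].
Qed.

Lemma conv_hull_sub V C :
  (forall x y (s t : R), 0 < s -> 0 < t -> s + t = 1 -> C x -> C y ->
    C (s *: x + t *: y)) -> V `<=` C -> conv_hull V `<=` C.
Proof. by move=> cC; apply: smallest_sub; apply/convex_setE. Qed.

Lemma sub_conv_hull V : V `<=` conv_hull V.
Proof. exact: sub_gen_smallest. Qed.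

(** The points [x] with [x + q] in the left-hand side form a convex set; this is
applied first for [q] in [W], then for [q] in the hull of [V]. *)
Lemma conv_hull_minkowski V W :
  conv_hull (minkowski_sum V W) = minkowski_sum (conv_hull V) (conv_hull W).
Proof.
have cS := (convex_setE _).1 (@convex_conv_hull (minkowski_sum V W)).
apply/seteqP; split.
  apply: conv_hull_sub => [x y s t s0 t0 st [x1 Cx1 [x2 Cx2 <-]]|].
    move=> [y1 Cy1 [y2 Cy2 <-]].
    exists (s *: x1 + t *: y1); first exact: ((convex_setE _).1 (@convex_conv_hull V)).
    exists (s *: x2 + t *: y2); first exact: ((convex_setE _).1 (@convex_conv_hull W)).
    by rewrite !scalerDr addrACA.
  by move=> _ [x Vx [y Wy <-]]; exists x; [|exists y => //]; exact: sub_conv_hull.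
have comb q x y (s t : R) : s + t = 1 ->
    s *: x + t *: y + q = s *: (x + q) + t *: (y + q).
  by move=> st; rewrite !scalerDr addrACA -scalerDl st scale1r.
have VW q : W q -> conv_hull V `<=` [set x | conv_hull (minkowski_sum V W) (x + q)].
  move=> Wq; apply: conv_hull_sub => [x y s t s0 t0 st /= Cx Cy|x Vx /=].
    by rewrite comb//; exact: cS.
  by apply: sub_conv_hull; exists x => //; exists q.
move=> _ [p Vp [q Wq <-]].
have : conv_hull W `<=` [set x | conv_hull (minkowski_sum V W) (x + p)].
  apply: conv_hull_sub => [x y s t s0 t0 st /= Cx Cy|x Wx /=].
    by rewrite comb//; exact: cS.
  by rewrite addrC; exact: VW.
by move=> /(_ q Wq) /=; rewrite addrC.
Qed.

Lemma polytope_minkowski P Q :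
  polytope P -> polytope Q -> polytope (minkowski_sum P Q).
Proof.
move=> [V fV ->] [W fW ->]; exists (minkowski_sum V W).
  exact: finite_image2.
by rewrite conv_hull_minkowski.
Qed.

Lemma polytope0 : polytope [set (0 : 'rV[R]_n)].
Proof.
exists [set 0]; first exact: finite_set1.
apply/seteqP; split; first exact: sub_conv_hull.
apply: conv_hull_sub => // x y s t s0 t0 st -> ->.
by rewrite !scaler0 addr0.
Qed.

Lemma polytope_sum (T : Type) (l : seq T) (F : T -> set 'rV[R]_n) :
  (forall i, polytope (F i)) -> polytope (\big[@minkowski_sum R n/[set 0]]_(i <- l) F i).
Proof.
move=> pF; elim: l => [|i l ih]; first by rewrite big_nil; exact: polytope0.
by rewrite big_cons; exact: polytope_minkowski.
Qed.

Definition maximizes w V x := V x /\ forall y, V y -> dotv w y <= dotv w x.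

Lemma conv_hull_le w V (c : R) :
  (forall y, V y -> dotv w y <= c) -> forall y, conv_hull V y -> dotv w y <= c.
Proof.
move=> Vc; apply: conv_hull_sub => // x y s t s0 t0 st xc yc.
rewrite dotvDr !dotvZr -[c]mul1r -st mulrDl.
by apply: lerD; rewrite ler_pM2l.
Qed.

Lemma face_conv_hull_vertex w V x : V x ->
  face w (conv_hull V) x <-> maximizes w V x.
Proof.
move=> Vx; split=> [[_ xm]|[_ xm]]; split=> //.
- by move=> y Vy; apply: xm; exact: sub_conv_hull.
- exact: sub_conv_hull.
- exact: conv_hull_le.
Qed.

(** The condition that maximizing [v] forces maximizing [w] cuts out a convex
subset [C] of the half-space bounding [V] in direction [v], because a proper convex
combination attains the bound only when both of its points do. *)
Lemma face_conv_hull_sub v w V x0 : maximizes v V x0 ->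
  (forall x, maximizes v V x -> maximizes w V x) ->
  face v (conv_hull V) `<=` face w (conv_hull V).
Proof.
move=> m0 vw; have [Vx0 max0] := m0; have [_ wmax0] := vw _ m0.
pose C := [set p | dotv v p <= dotv v x0 /\
  (dotv v p = dotv v x0 -> dotv w x0 <= dotv w p)].
have VC : conv_hull V `<=` C.
  apply: conv_hull_sub => [x y s t s0 t0 st [xv xw] [yv yw]|x Vx].
    have le1 : s * dotv v x <= s * dotv v x0 by rewrite ler_pM2l.
    have le2 : t * dotv v y <= t * dotv v x0 by rewrite ler_pM2l.
    have e0 u : dotv u x0 = s * dotv u x0 + t * dotv u x0.
      by rewrite -mulrDl st mul1r.
    rewrite /C /= !dotvDr !dotvZr; split; first by rewrite e0 lerD.
    rewrite [dotv v x0]e0 [dotv w x0]e0 => e.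
    have ex : s * dotv v x = s * dotv v x0.
      by apply/eqP; rewrite eq_le le1 /= -(lerD2r (t * dotv v x0)) -e lerD2l.
    have ey : t * dotv v y = t * dotv v x0 by apply: (addrI (s * dotv v x)); rewrite e ex.
    apply: lerD; rewrite ler_pM2l//; [apply: xw | apply: yw].
      by apply: (mulfI (lt0r_neq0 s0)).
    by apply: (mulfI (lt0r_neq0 t0)).
  split; first exact: max0.
  move=> xE; apply: (vw x _).2 => //; split=> // y Vy; rewrite xE; exact: max0.
move=> p [Vp pm]; split=> // q Vq.
have [le1 H] := VC p Vp.
have -> // : dotv w q <= dotv w p.
apply: le_trans (H _); first exact: conv_hull_le Vq.
by apply/eqP; rewrite eq_le le1 pm//; exact: sub_conv_hull.
Qed.

Lemma face_conv_hull_eqP v w V x y : maximizes v V x -> maximizes w V y ->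
  face v (conv_hull V) = face w (conv_hull V) <->
  (forall z, V z -> maximizes v V z <-> maximizes w V z).
Proof.
move=> vx wy; split=> [e z Vz|vw].
  by rewrite -!face_conv_hull_vertex// e.
by apply/seteqP; split; [apply: (face_conv_hull_sub vx) | apply: (face_conv_hull_sub wy)];
  move=> z mz; have [Vz _] := mz; apply/(vw z Vz).
Qed.

Definition has_faces P := forall w, exists p, face w P p.

Lemma face_minkowski w P Q p q : P p -> Q q ->
  face w (minkowski_sum P Q) (p + q) <-> face w P p /\ face w Q q.
Proof.
move=> Pp Qq; split=> [[_ m]|[[_ mp] [_ mq]]].
  split; split=> // x Px.
    by rewrite -(lerD2r (dotv w q)) -!dotvDr; apply: m; exists x => //; exists q.
  by rewrite -(lerD2l (dotv w p)) -!dotvDr; apply: m; exists p => //; exists x.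
split; first by exists p => //; exists q.
by move=> _ [x Px [y Qy <-]]; rewrite !dotvDr lerD ?mp ?mq.
Qed.

Lemma has_faces_minkowski P Q :
  has_faces P -> has_faces Q -> has_faces (minkowski_sum P Q).
Proof.
move=> fP fQ w; have [p pf] := fP w; have [q qf] := fQ w.
by exists (p + q); apply/face_minkowski; [case: pf | case: qf |].
Qed.

(** A point of a face of [P] is recovered by adding any point of the face of [Q]
in the same direction, which must be nonempty. *)
Lemma face_minkowski_eqP v w P Q : has_faces P -> has_faces Q ->
  face v (minkowski_sum P Q) = face w (minkowski_sum P Q) <->
  face v P = face w P /\ face v Q = face w Q.
Proof.
have subl v' w' P' Q' : has_faces Q' ->
    face v' (minkowski_sum P' Q') = face w' (minkowski_sum P' Q') ->
    face v' P' `<=` face w' P'.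
  move=> fQ e p pf; have [q qf] := fQ v'.
  have Pp := pf.1; have Qq := qf.1.
  have : face v' (minkowski_sum P' Q') (p + q) by apply/face_minkowski.
  by rewrite e => /face_minkowski[].
move=> fP fQ; split=> [e|[eP eQ]].
  have e' : face v (minkowski_sum Q P) = face w (minkowski_sum Q P).
    by rewrite minkowski_sumC e minkowski_sumC.
  by split; apply/seteqP; split; first [exact: subl e | exact: subl (esym e)
    | exact: subl e' | exact: subl (esym e')].
apply/seteqP; split=> x xf; have [[p Pp [q Qq xE]] _] := xf; move: xf;
  rewrite -xE => /face_minkowski-/(_ Pp Qq) pq; apply/face_minkowski => //.
  by rewrite -eP -eQ.
by rewrite eP eQ.
Qed.

Lemma has_faces_sum (T : eqType) (l : seq T) (F : T -> set 'rV[R]_n) :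
  (forall i, has_faces (F i)) ->
  has_faces (\big[@minkowski_sum R n/[set 0]]_(i <- l) F i).
Proof.
move=> fF; elim: l => [|i l ih]; last by rewrite big_cons; exact: has_faces_minkowski.
by rewrite big_nil => w; exists 0; split=> // q ->.
Qed.

Lemma face_sum_eqP (T : eqType) (l : seq T) (F : T -> set 'rV[R]_n) v w :
  (forall i, has_faces (F i)) ->
  face v (\big[@minkowski_sum R n/[set 0]]_(i <- l) F i) =
  face w (\big[@minkowski_sum R n/[set 0]]_(i <- l) F i) <->
  (forall i, i \in l -> face v (F i) = face w (F i)).
Proof.
move=> fF; elim: l => [|i l ih].
  split=> // _; rewrite big_nil.
  by apply/seteqP; split=> x [-> _]; split=> // q ->.
rewrite big_cons face_minkowski_eqP//; last exact: has_faces_sum.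
rewrite ih; split=> [[ei el] j|H].
  by rewrite inE => /predU1P[->|/el].
by split=> [|j jl]; apply: H; rewrite inE ?eqxx ?jl ?orbT.
Qed.

End Polytopes.

(** * State polytopes *)

Section StatePolytopes.
Variables (R : realType) (k : fieldType) (n : nat) (A : zmodType).
Variables (a : 'I_n -> A) (I : set (mpoly n k)).
Hypotheses (a_pos : positively_graded k a) (I_hom : homogeneous_ideal a I).
Implicit Types (v w : 'rV[R]_n) (s : A) (lt : rel (multinom n)).

Let mon_weight w : multinom n -> R := fun m => dotv w (expvec R m).

Let mon_weightD w : weight_additive (mon_weight w).
Proof.
move=> u m; rewrite /mon_weight -dotvDr; congr dotv.
by apply/rowP => i; rewrite !mxE mnmDE natrD.
Qed.

Let lin_closed_piece s : lin_closed (piece a I s).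
Proof. by apply: piece_lin_closed; case: I_hom => /is_ideal_lin_closed. Qed.

Lemma initial_sumE s (N : seq (multinom n)) lt : uniq N ->
  (forall m, (m \in N) = (mdegA a m == s)) -> mult_order lt ->
  initial_sum R a I s lt =
  \sum_(m <- initial_seq N (piece a I s) lt) expvec R m.
Proof.
move=> uN NE lto; rewrite fsbig_seq ?filter_uniq// /initial_sum.
apply: eq_fsbigl; apply/funext => m; apply/propext.
have sN := piece_supported (J := I) NE.
apply: (iff_trans (initial_monomials_piece s m lto I_hom)).
exact: iff_sym (mem_initial_seq lt m sN).
Qed.

(** The initial bases of degree [s] are subsequences of the finite list [N]. *)
Lemma state_polytope s : polytope (state R a I s).
Proof.
have [N uN NE] := degree_seq a_pos s.
exists (initial_sum R a I s @` @mult_order n) => //.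
apply: (@sub_finite_set _ _ ((fun b : (size N).-tuple bool =>
    \sum_(m <- mask b N) expvec R m) @` setT)).
  move=> _ [lt lto <-]; rewrite (initial_sumE uN NE lto) /initial_seq filter_mask.
  have sz : size [seq `[< initial_monomials (order_le lt) (piece a I s) m >] | m <- N]
      == size N by rewrite size_map.
  by exists (Tuple sz).
exact/finite_image/finite_finset.
Qed.

Lemma maximizes_initial_sum w s (N : seq (multinom n)) lt : uniq N ->
  (forall m, (m \in N) = (mdegA a m == s)) -> mult_order lt ->
  maximizes w (initial_sum R a I s @` @mult_order n) (initial_sum R a I s lt) <->
  optimal N (piece a I s) (mon_weight w) lt.
Proof.
move=> uN NE lto.
have dE lt' : mult_order lt' -> dotv w (initial_sum R a I s lt') =
    weight (mon_weight w) (initial_seq N (piece a I s) lt').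
  by move=> lto'; rewrite (initial_sumE uN NE lto') dotv_sum.
split=> [[_ m] lt' lto'|opt].
  by rewrite -!dE//; apply: m; exists lt'.
by split=> [|_ [lt' lto' <-]]; [exists lt | rewrite !dE//; exact: opt].
Qed.

Lemma initial_sum_maximum w s : exists lt, mult_order lt /\
  maximizes w (initial_sum R a I s @` @mult_order n) (initial_sum R a I s lt).
Proof.
have [N uN NE] := degree_seq a_pos s; have sN := piece_supported (J := I) NE.
have [lt0 lto0] := mult_order_exists n.
have lto := refine_order_mult (@mon_weightD w) lto0.
exists (refine_order (mon_weight w) lt0); split=> //.
apply/(maximizes_initial_sum _ uN NE lto).
exact: refine_optimal.
Qed.

Lemma state_has_faces s : has_faces (state R a I s).
Proof.
move=> w; have [lt [lto m]] := initial_sum_maximum w s.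
by exists (initial_sum R a I s lt); apply/face_conv_hull_vertex => //; case: m.
Qed.

(** The hull is taken over the exponent sums of the initial bases, and the value
of [w] on such a sum is the weight of the basis; so [init_space_eqP] compares the
maximizing vertices of the two faces. *)
Lemma state_face_eqP v w s :
  face v (state R a I s) = face w (state R a I s) <->
  piece a (in_wt_ideal v I) s = piece a (in_wt_ideal w I) s.
Proof.
have [N uN NE] := degree_seq a_pos s; have sN := piece_supported (J := I) NE.
have pE u : piece a (in_wt_ideal u I) s =
    init_space (weight_le (mon_weight u)) (piece a I s).
  apply: (@init_ideal_piece _ _ _ _ (weight_le (mon_weight u))) => //.
    exact: weight_le_preorder.
  exact: weight_le_compatible.
rewrite !pE (init_space_eqP uN)//.
have [ltv [_ mv]] := initial_sum_maximum v s.
have [ltw [_ mw]] := initial_sum_maximum w s.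
rewrite (face_conv_hull_eqP mv mw); split=> [H lt lto|H _ [lt lto <-]].
  by rewrite -!(maximizes_initial_sum _ uN NE lto); apply: H; exists lt.
by rewrite !(maximizes_initial_sum _ uN NE lto); exact: H.
Qed.

Lemma truncation_state_sumP (Om : set A) (G : set (mpoly n k)) v w :
  truncating a Om -> universal_grobner_basis I G ->
  (forall g, G g -> exists s : A, graded_piece a s g) ->
  finite_set (Om `&` degrees a G) ->
  face v (state_sum R a I (Om `&` degrees a G)) =
  face w (state_sum R a I (Om `&` degrees a G)) <->
  truncation a Om (in_wt_ideal v I) = truncation a Om (in_wt_ideal w I).
Proof.
move=> Omt Gu Gh fT.
have I0 u : in_wt_ideal u I 0 by case: (ideal_gen_ideal (in_wt u @` (I `\ 0))).
rewrite truncation_eqP// /state_sum fsbig_finite// face_sum_eqP; last first.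
  exact: state_has_faces.
split=> [H s Oms|H s]; last first.
  by rewrite in_fset_set// inE => -[Oms _]; apply/state_face_eqP; exact: H.
have e t : (Om `&` degrees a G) t ->
    piece a (in_wt_ideal v I) t = piece a (in_wt_ideal w I) t.
  by move=> Tt; apply/state_face_eqP; apply: H; rewrite in_fset_set// inE.
by apply/seteqP; split;
  apply: (@init_piece_extend k n A a a_pos R I G Om (mon_weight _) (mon_weight _)) => //;
  move=> t Tt; have := e t Tt; rewrite -/(in_wt_ideal _ I).
Qed.

End StatePolytopes.

Lemma finite_degrees (k : fieldType) n (A : zmodType) (a : 'I_n -> A)
    (G : set (mpoly n k)) : finite_set G -> finite_set (degrees a G).
Proof.
move=> fG; apply: (@sub_finite_set _ _
    ((fun g => mdegA a (head (@mnm0 n) (msupp g))) @` G)).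
  move=> s [g [Gg g0] gs]; exists g => //; apply: gs.
  have : msupp g != [::] by rewrite msupp_eq0; apply/eqP.
  by case: (msupp g) => // m l _; exact: mem_head.
exact: finite_image.
Qed.

Theorem mainTheorem2 (R : realType) (k : fieldType) (n : nat) (A : zmodType)
    (a : 'I_n -> A) (I : set (mpoly n k)) (Om : set A) (G : set (mpoly n k))
    (a_pos : positively_graded k a)
    (I_hom : homogeneous_ideal a I)
    (Om_trunc : truncating a Om)
    (G_ugb : universal_grobner_basis I G)
    (G_hom : forall g, G g -> exists s : A, graded_piece a s g) :
  [/\ normal_fan (state_sum R a I (Om `&` degrees a G))
        = truncated_grobner_fan R a I Om,
      exists2 P : set 'rV[R]_n,
        minkowski_summand P (state_sum R a I (degrees a G))
        & truncated_grobner_fan R a I Om = normal_fan P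
    & coarsening (truncated_grobner_fan R a I Om) (grobner_fan R I)].
Proof.
have fG : finite_set (degrees a G) by case: G_ugb => fG _ _; exact: finite_degrees.
have fOm : finite_set (Om `&` degrees a G) by exact: finite_setIr.
have poly T : finite_set T -> polytope (state_sum R a I T).
  move=> fT; rewrite /state_sum fsbig_finite//; apply: polytope_sum => s.
  exact: state_polytope.
have fanE : normal_fan (state_sum R a I (Om `&` degrees a G)) =
    truncated_grobner_fan R a I Om.
  apply: (congr1 (fun cone => range cone)); apply/funext => w; congr closure.
  by apply/seteqP; split=> v /= /truncation_state_sumP; apply.
split=> //.
  exists (state_sum R a I (Om `&` degrees a G)) => //.
  split; first exact: poly.
  exists (state_sum R a I (degrees a G `&` ~` Om)).
    by apply: poly; exact: finite_setIl.
  by rewrite {1}/state_sum (fsbigID Om)// [degrees a G `&` Om]setIC.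
move=> _ [w _ <-]; exists (closure [set v : 'rV[R]_n |
    truncation a Om (in_wt_ideal v I) = truncation a Om (in_wt_ideal w I)]).
  by exists w.
by apply: closureS => v /= ->.
Qed.
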